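(* Let $\mu,\nu$ be probability measures on $\mathbb{R}$ with $\mu\preceq\nu$ in convex order, such that $J:=\mathrm{conv}(\mathrm{supp}(\nu))$ is compact. Let $c:\mathbb{R}\times\mathbb{R}\to\mathbb{R}$ be a lower-semicontinuous cost satisfying $c(x,y)\le a(x)+b(y)$ for some $a\in L^1(\mu)$, $b\in L^1(\nu)$, with $\mathbf{P}(c):=\inf_{\mathbb{P}\in\mathsf{M}(\mu,\nu)}\mathbb{E}^{\mathbb{P}}[c(X,Y)]$ finite. Assume $c$ is Lipschitz on $J\times J$ and there is a Lipschitz function $u:J\to\mathbb{R}$ such that $y\mapsto c(x,y)+u(y)$ is convex on $J$ for $\mu$-a.e. $x$. Then there exists a dual maximizer $(f,g,h)$ such that $f$ and $g$ are Lipschitz on $J$ and $h$ is bounded on $J$. In particular, $\nu(g)-\mu(f)=\mathbb{E}^{\mathbb{P}^*}[c(X,Y)]$ for every minimizer $\mathbb{P}^*$, where $\mu(f)=\int f\,d\mu$ and $\nu(g)=\int g\,d\nu$.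
   Context: $(X,Y)$ denotes the canonical process on $\Omega=\mathbb{R}\times\mathbb{R}$. $\mu\preceq\nu$ in convex order means $\int\xi\,d\mu\le\int\xi\,d\nu$ for every convex $\xi$. $\mathsf{M}(\mu,\nu)$ is the set of probability measures $\mathbb{P}$ on $\Omega$ with $X\sim_{\mathbb{P}}\mu$, $Y\sim_{\mathbb{P}}\nu$ and $\mathbb{E}^{\mathbb{P}}[Y|X]=X$ $\mathbb{P}$-a.s. A minimizer is a $\mathbb{P}^*\in\mathsf{M}(\mu,\nu)$ with $\mathbb{E}^{\mathbb{P}^*}[c(X,Y)]=\mathbf{P}(c)$. A dual maximizer is a triple of functions $f:\mathbb{R}\to\mathbb{R}\cup\{+\infty\}$, $g:\mathbb{R}\to\mathbb{R}\cup\{-\infty\}$, $h:\mathbb{R}\to\mathbb{R}$ such that $f$ is finite $\mu$-a.s., $g$ is finite $\nu$-a.s., $g(y)-f(x)-h(x)(y-x)\le c(x,y)$ for all $x,y\in\mathbb{R}$, and for every minimizer $\mathbb{P}^*$ one has $g(y)-f(x)-h(x)(y-x)=c(x,y)$ for $\mathbb{P}^*$-a.e. $(x,y)$. *)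

(* Defs.v *)
From HB Require Import structures.
From mathcomp Require Import all_boot all_order all_algebra.
From mathcomp Require Import all_classical all_reals all_analysis.
Set Implicit Arguments. Unset Strict Implicit. Unset Printing Implicit Defensive.
Import Order.TTheory GRing.Theory Num.Theory.
Local Open Scope classical_set_scope.
Local Open Scope ring_scope.

Section defs.
Variable R : realType.
Local Open Scope ereal_scope.

Definition finite_first_moment (m : probability R R) :=
  m.-integrable setT (fun x : R => x%:E).

Definition convex_fun_on (D : set R) (f : R -> R) :=
  forall x y (t : R), D x -> D y -> (0 <= t <= 1)%R ->
    (f (t * x + (1 - t) * y) <= t * f x + (1 - t) * f y)%R.

(* mu <= nu in convex order (both with finite first moment, so that
   integrals of convex functions are well defined in (-oo, +oo]) *)
Definition convex_order (mu nu : probability R R) :=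
  finite_first_moment mu /\ finite_first_moment nu /\
  forall xi : R -> R, convex_fun_on setT xi ->
    \int[mu]_x (xi x)%:E <= \int[nu]_x (xi x)%:E.

Definition msupport (m : probability R R) : set R :=
  [set x : R | forall e : R, (0 < e)%R -> 0 < m [set z : R | (x - e < z < x + e)%R]].

Definition conv_hull (S : set R) : set R :=
  [set z | exists a b, [/\ S a, S b & (a <= z <= b)%R]].

Definition mart_coupling (mu nu : probability R R)
    (P : probability (R * R)%type R) :=
  [/\ forall A : set R, measurable A -> P (fst @^-1` A) = mu A,
      forall A : set R, measurable A -> P (snd @^-1` A) = nu A,
      P.-integrable setT (fun z : R * R => z.2%:E) &
      forall A : set R, measurable A ->
        \int[P]_(z in fst @^-1` A) z.2%:E = \int[P]_(z in fst @^-1` A) z.1%:E].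

Definition cost_exp (c : R -> R -> R) (P : probability (R * R)%type R) : \bar R :=
  \int[P]_z (c z.1 z.2)%:E.

Definition primal_value (mu nu : probability R R) (c : R -> R -> R) : \bar R :=
  ereal_inf [set cost_exp c P | P in [set P | mart_coupling mu nu P]].

Definition minimizer (mu nu : probability R R) (c : R -> R -> R)
    (P : probability (R * R)%type R) :=
  mart_coupling mu nu P /\ cost_exp c P = primal_value mu nu c.

Definition dual_maximizer (mu nu : probability R R) (c : R -> R -> R)
    (f g : R -> \bar R) (h : R -> R) :=
  [/\ (forall x, f x != -oo) /\ (forall y, g y != +oo),
      {ae mu, forall x, f x \is a fin_num},
      {ae nu, forall y, g y \is a fin_num},
      forall x y, g y - f x - (h x * (y - x))%:E <= (c x y)%:E &
      forall P, minimizer mu nu c P ->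
        {ae P, forall z : R * R,
           g z.2 - f z.1 - (h z.1 * (z.2 - z.1))%:E = (c z.1 z.2)%:E}].

Definition lip_on (D : set R) (f : R -> R) :=
  exists L : R, forall x y, D x -> D y -> (`|f x - f y| <= L * `|x - y|)%R.

Definition lip2_on (D : set R) (c : R -> R -> R) :=
  exists L : R, forall x y x' y', D x -> D y -> D x' -> D y' ->
    (`|c x y - c x' y'| <= L * (`|x - x'| + `|y - y'|))%R.

Definition elip_on (D : set R) (f : R -> \bar R) :=
  exists fr : R -> R, lip_on D fr /\ forall x, D x -> f x = (fr x)%:E.

End defs.

(* Main.v *)
(* For H > 0, relax the martingale constraint by allowing only multipliers h with
   |h| <= H.  With c convexified and L-Lipschitz, every dual potential g of the
   relaxed problem may be taken (H + L)-Lipschitz, and f may be taken to be the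
   H-Lipschitz concave envelope of g - c(x, .) at x, so the relaxed dual is
   attained by compactness.  Hahn-Banach then yields a coupling P of mu and nu for
   which complementary slackness holds: g(y) - f(x) - h(x)(y - x) = c(x, y) P-a.s.,
   and on average Y - X is >= 0 where h is near H, <= 0 where h is near -H, and 0
   elsewhere.

   If H > L + 1 and P is not a martingale, some contact pair has h near H.  Since
   c(x, .) is convex, the steepness of g it creates propagates to the right along
   contact pairs, up to a point x0 that P does not cross.  Then
   E(x0 - Y)^+ < E(x0 - X)^+, against mu <= nu in convex order.  Hence P is a
   martingale coupling whose cost equals the dual value, so the Lipschitz triple
   (f, g, h) is optimal in the original problem. *)

Require Import Defs.
From HB Require Import structures.
From mathcomp Require Import all_boot all_order all_algebra.
From mathcomp Require Import all_classical all_reals all_analysis.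
From mathcomp Require Import measurable_realfun.
From mathcomp Require Import ring lra.
Set Implicit Arguments. Unset Strict Implicit. Unset Printing Implicit Defensive.
Import Order.TTheory GRing.Theory Num.Theory numFieldNormedType.Exports.
Local Open Scope classical_set_scope.
Local Open Scope ring_scope.

(** * Couplings from finitely additive set functions *)

(** Nothing controls the multiplier [h] a priori, and this is the obstacle to dual attainment: [h]
    is capped by hand, and the cap is then shown to create no drift. In the cap [L + 2], the cost
    uses up [L] and one unit makes [g] climb at rate 1 along contact pairs. The barrier is needed
    for upward drift only: [mu] and [nu] have equal means, so downward drift disappears with it.

    Hahn-Banach is applied on all bounded functions of the plane and returns only a finitely
    additive object. Its marginals are true measures on the line, and their regularity forces
    countable additivity on rectangles. The functional and the resulting measure agree on functions
    measurable in [x] and Lipschitz in [y], which suffices for integrands containing [h].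

    Convexity of [c + u] in [y] is given for [mu]-a.e. [x], while the barrier uses it at every [x]
    of the interval; the cost is therefore replaced by one that agrees with [c + u] at those [x].
    Adding [u] shifts all costs by a constant, since the law of [Y] is fixed. *)

Section regularity.
Variable R : realType.
Implicit Type m : probability R R.
Local Open Scope ereal_scope.

Definition regular_set m (A : set R) := forall e : R, (0 < e)%R ->
  exists F U, [/\ closed F, open U, F `<=` A, A `<=` U & m (U `\` F) < e%:E].

Lemma regular_setC m A : regular_set m A -> regular_set m (~` A).
Proof.
move=> rA e e0; have [F [U [cF oU FA AU mUF]]] := rA e e0.
exists (~` U), (~` F); split.
- exact: open_closedC.
- exact: closed_openC.
- exact: subsetC.
- exact: subsetC.
- by rewrite setDE setCK setIC -setDE.
Qed.

Lemma bigcap_lt d (T : measurableType d) (m : probability T R) (F : (set T)^nat) e :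
  (forall n, measurable (F n)) -> nonincreasing_seq F ->
  m (\bigcap_n F n) < e -> exists n, m (F n) < e.
Proof.
move=> mF niF me.
have mcap : measurable (\bigcap_n F n) by exact: bigcapT_measurable.
have cvg : m \o F @ \oo --> m (\bigcap_n F n).
  apply: nonincreasing_cvg_mu => //.
  by rewrite (le_lt_trans (probability_le1 _ _)) ?ltry.
have : \forall n \near \oo, m (F n) < e := cvg _ (open_ereal_lt' me).
by move=> /filter_ex.
Qed.

(** The union of the inner closed sets need not be closed, so only finitely many are kept;
    continuity from above makes the discarded remainder small. Half of [e] pays for the errors of
    the single sets, the rest for the truncation. *)
Lemma regular_bigcup m (A : (set R)^nat) :
  (forall n, regular_set m (A n)) -> regular_set m (\bigcup_n A n).
Proof.
move=> rA e e0.
have e20 : (0 < e / 2)%R by rewrite divr_gt0.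
have /choice[FU HFU] : forall n, exists FU : set R * set R,
    [/\ closed FU.1, open FU.2, FU.1 `<=` A n, A n `<=` FU.2 &
    m (FU.2 `\` FU.1) < (e / 2 / (2 ^ n.+1)%:R)%:E].
  move=> n; have [|F [U ?]] := rA n (e / 2 / (2 ^ n.+1)%:R)%R.
    by rewrite divr_gt0// ltr0n expn_gt0.
  by exists (F, U).
pose F n := (FU n).1; pose U n := (FU n).2.
have mF n : measurable (F n) by apply: closed_measurable; have [] := HFU n.
have mU n : measurable (U n) by apply: open_measurable; have [] := HFU n.
pose G n := \big[setU/set0]_(i < n) F i.
have mG n : measurable (G n) by exact: bigsetU_measurable.
have mFT : measurable (\bigcup_n F n) by exact: bigcupT_measurable.
have mUT : measurable (\bigcup_n U n) by exact: bigcupT_measurable.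
have h1 : m (\bigcup_n U n `\` \bigcup_n F n) <= (e / 2)%:E.
  apply: (@le_trans _ _ (\sum_(n <oo) m (U n `\` F n))).
    apply: measure_sigma_subadditive => [n||].
    - exact: measurableD.
    - exact: measurableD.
    - move=> x [[n _ Ux] nF]; exists n => //; split => // Fx.
      by apply: nF; exists n.
  apply: le_trans (epsilon_trick0 xpredT (ltW e20)).
  by apply: lee_nneseries => // n _; apply: ltW; have [] := HFU n.
have [N HN] : exists N, m (\bigcup_n U n `\` G N) < e%:E.
  apply: bigcap_lt.
  - by move=> n; exact: measurableD.
  - move=> a b ab; apply/subsetPset => x [Ux nG]; split => // Gx; apply: nG.
    by apply: subset_bigsetU Gx.
  have -> : \bigcap_n (\bigcup_n U n `\` G n) =
      \bigcup_n U n `\` \bigcup_n F n.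
    apply/seteqP; split => x.
      move=> h; split; first by have [] := h 0%N I.
      move=> [n _ Fx]; have [_] := h n.+1 I; apply.
      by rewrite /G -bigcup_mkord; exists n => /=.
    move=> [Ux nF] n _; split => //.
    by rewrite /G -bigcup_mkord => -[k _ Fx]; apply: nF; exists k.
  by apply: le_lt_trans h1 _; rewrite lte_fin; lra.
exists (G N), (\bigcup_n U n); split => //.
- rewrite /G -bigcup_mkord; apply: closed_bigcup => [|n _].
    exact: finite_II.
  by have [] := HFU n.
- by apply: bigcup_open => n _; have [] := HFU n.
- by rewrite /G -bigcup_mkord => x [n _ Fx]; exists n => //;
  have [_ _ + _ _] := HFU n; exact.
- by move=> x [n _ Ax]; exists n => //; have [_ _ _ + _] := HFU n; exact.
Qed.

Lemma regular_itvoo m (x y : R) : regular_set m `]x, y[%classic.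
Proof.
move=> e e0.
pose F n := `[(x + n.+1%:R^-1)%R, (y - n.+1%:R^-1)%R]%classic : set R.
have [N HN] : exists N, m (`]x, y[%classic `\` F N) < e%:E.
  apply: bigcap_lt.
  - by move=> n; apply: measurableD; exact: measurable_itv.
  - move=> a b ab; apply/subsetPset => t [Ut nF]; split => // Ft; apply: nF.
    have : (b.+1%:R^-1 <= a.+1%:R^-1 :> R)%R by rewrite lef_pV2 ?posrE// ler_nat.
    move: Ft; rewrite /F /= !in_itv /=.
    move: (a.+1%:R^-1)%R (b.+1%:R^-1)%R => p q /andP[? ?] ?.
    by apply/andP; split; lra.
  rewrite (_ : \bigcap_n _ = set0) ?measure0 ?lte_fin//.
  apply/seteqP; split => // t /= h; have [] := h 0%N I.
  rewrite /= in_itv /= => /andP[xt ty] _.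
  have [k1 hk1] := ltr_add_invr xt; have [k2 hk2] := ltr_add_invr ty.
  have [_] := h (maxn k1 k2) I; apply; rewrite /F /= in_itv /=.
  have h1 : ((maxn k1 k2).+1%:R^-1 <= k1.+1%:R^-1 :> R)%R.
    by rewrite lef_pV2 ?posrE// ler_nat ltnS leq_maxl.
  have h2 : ((maxn k1 k2).+1%:R^-1 <= k2.+1%:R^-1 :> R)%R.
    by rewrite lef_pV2 ?posrE// ler_nat ltnS leq_maxr.
  move: (_^-1)%R (_^-1)%R (_^-1)%R hk1 hk2 h1 h2 => p q s ? ? ? ?.
  by apply/andP; split; lra.
exists (F N), `]x, y[%classic; split => //; first by apply: interval_closed.
have : (0 < N.+1%:R^-1 :> R)%R by rewrite invr_gt0.
  rewrite /F; move: (_^-1)%R => p ? t.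
  by rewrite /= !in_itv /= => /andP[? ?]; apply/andP; split; lra.
Qed.

Lemma measurable_regular m (A : set R) : measurable A -> regular_set m A.
Proof.
have -> : @measurable _ R = <<s @RGenOpens.G R >> by exact: RGenOpens.measurableE.
apply: smallest_sub => [|B [x [y ->]]]; last exact: regular_itvoo.
split.
- by move=> e e0; exists set0, set0; split => //;
  [exact: closed0|rewrite set0D measure0 lte_fin].
- by move=> B rB; rewrite setTD; exact: regular_setC.
- exact: regular_bigcup.
Qed.

(** The closed inner set is cut by [[- N, N]], whose complement has small mass because these
    complements decrease to the empty set. *)
Lemma inner_compact m (A : set R) (e : R) : measurable A -> (0 < e)%R ->
  exists K, [/\ compact K, K `<=` A & m (A `\` K) < e%:E].
Proof.
move=> mA e0; have e20 : (0 < e / 2)%R by rewrite divr_gt0.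
have [F [U [cF oU FA AU mUF]]] := measurable_regular m mA e20.
pose B n := `[(- n%:R)%R, n%:R]%classic : set R.
have mF := closed_measurable cF.
have mU := open_measurable oU.
have [N HN] : exists N, m (~` B N) < (e / 2)%:E.
  apply: bigcap_lt.
  - by move=> n; apply: measurableC; exact: measurable_itv.
  - move=> a b ab; apply/subsetPset; apply: subsetC => t.
    have : (a%:R <= b%:R :> R)%R by rewrite ler_nat.
    by rewrite /B /= !in_itv /= => ? /andP[? ?]; apply/andP; split; lra.
  rewrite (_ : \bigcap_n _ = set0) ?measure0 ?lte_fin//.
  apply/seteqP; split => // t /= h.
  have := archi_boundP (normr_ge0 t); set n := Num.bound _ => tn.
  apply: (h n I); rewrite /B /= in_itv /=.
  by move: (ltW tn); rewrite ler_norml.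
exists (F `&` B N); split.
- apply: (subclosed_compact _ (@segment_compact _ (- N%:R)%R N%:R)).
    by apply: closedI => //; apply: interval_closed.
  by move=> ? [].
- by move=> ? [/FA].
- apply: (@le_lt_trans _ _ (m (U `\` F) + m (~` B N))).
    apply: (@le_trans _ _ (m ((U `\` F) `|` ~` B N))).
      apply: le_measure; rewrite ?inE.
      - by apply: measurableD => //; apply: measurableI => //;
        exact: measurable_itv.
      - apply: measurableU; first exact: measurableD.
        by apply: measurableC; exact: measurable_itv.
      - move=> t [At nK]; have [Bt|nB] := pselect (B N t); last by right.
        by left; split; [exact: AU|move=> Ft; apply: nK].
    apply: measureU2; first exact: measurableD.
    by apply: measurableC; exact: measurable_itv.
  by rewrite (splitr e) EFinD lteD.
Qed.

Lemma outer_open m (A : set R) (e : R) : measurable A -> (0 < e)%R ->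
  exists U, [/\ open U, A `<=` U & m (U `\` A) < e%:E].
Proof.
move=> mA e0; have [F [U [cF oU FA AU mUF]]] := measurable_regular m mA e0.
exists U; split => //; apply: le_lt_trans mUF.
have mU := open_measurable oU.
have mF := closed_measurable cF.
by apply: le_measure; rewrite ?inE; [exact: measurableD|exact: measurableD|exact: setDS].
Qed.

End regularity.

Section rectangles.
Variable R : realType.

Definition rect : set (set (R * R)) :=
  [set A `*` B | A in measurable & B in measurable].

(** An alias of the plane, so that the semiring of rectangles does not clash with the product
    sigma-algebra already attached to [R * R]. *)
Definition rect_type : Type := (R * R)%type.

Lemma rect0 : rect set0.
Proof. by exists set0 => //; exists set0 => //; rewrite setX0. Qed.

Lemma rectI : setI_closed rect.
Proof.
move=> _ _ [A mA [B mB <-]] [A' mA' [B' mB' <-]].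
exists (A `&` A'); first exact: measurableI.
by exists (B `&` B'); [exact: measurableI|rewrite setXI].
Qed.

Lemma rectD : semi_setD_closed rect.
Proof.
move=> _ _ [A mA [B mB <-]] [A' mA' [B' mB' <-]].
exists [set (A `\` A') `*` B; (A `&` A') `*` (B `\` B')]; split.
- exact: finite_set2.
- move=> X [->|->].
    by exists (A `\` A'); [exact: measurableD|exists B].
  exists (A `&` A'); first exact: measurableI.
  by exists (B `\` B') => //; exact: measurableD.
- rewrite bigcup_setU !bigcup_set1; apply/seteqP; split => -[x y] /=.
    move=> [[Ax By] nAB]; have [A'x|] := pselect (A' x).
      by right; do 2 split => //; move=> B'y; exact: nAB.
    by left.
  move=> [[[Ax nA'x] By]|[[Ax A'x] [By nB'y]]]; split => //.
    by move=> -[].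
  by move=> -[].
- by move=> X Y [->|->] [->|->] // -[[x y] []]; rewrite /setX /setD /setI /=; tauto.
Qed.

HB.instance Definition _ := Pointed.on rect_type.
HB.instance Definition _ := @isSemiRingOfSets.Build default_measure_display
  rect_type rect rect0 rectI rectD.

End rectangles.

Lemma compact_coverR2 (R : realType) (K : set (R * R)) :
  compact K -> @cover_compact (R * R)%type K.
Proof.
pose T : ptopologicalType := HB.pack_for ptopologicalType (R * R)%type
  (Pointed.on (R * R)%type) (Topological.on (R * R)%type).
by have /(congr1 (fun P => P K)) <- := @compact_cover T.
Qed.

Lemma open_setX (S T : topologicalType) (U : set S) (V : set T) :
  open U -> open V -> open (U `*` V).
Proof.
rewrite !openE => oU oV -[x y] [/= Ux Vy].
by exists (U, V) => //; split; [exact: oU|exact: oV].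
Qed.

Section bimeasure.
Variables (R : realType) (mu nu : probability R R) (lam : set (R * R) -> R).
Hypotheses (lam_ge0 : forall A, 0 <= lam A)
  (lamU : forall A B, A `&` B = set0 -> lam (A `|` B) = lam A + lam B)
  (lam_fst : forall A, measurable A -> (lam (A `*` setT))%:E = mu A)
  (lam_snd : forall B, measurable B -> (lam (setT `*` B))%:E = nu B).

Lemma lam_set0 : lam set0 = 0.
Proof. by have := lamU (setI0 set0); rewrite setU0 => /eqP;
  rewrite -subr_eq subrr => /eqP. Qed.

Lemma le_lam A B : A `<=` B -> lam A <= lam B.
Proof.
move=> AB; have -> : B = A `|` (B `\` A) by rewrite setDUK.
by rewrite lamU ?setDIK// lerDl.
Qed.

Lemma le_lamU A B : lam (A `|` B) <= lam A + lam B.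
Proof.
rewrite -(setDUK (@subsetUl _ A B)) lamU ?setDIK// lerD2l le_lam//.
by move=> x [[]].
Qed.

Lemma lam_bigsetU (F : (set (R * R))^nat) n :
  lam (\big[setU/set0]_(i < n) F i) <= \sum_(i < n) lam (F i).
Proof.
elim: n => [|n IH]; first by rewrite !big_ord0 lam_set0.
by rewrite !big_ord_recr/= (le_trans (le_lamU _ _))// lerD2r.
Qed.

Definition lam_content (A : set (rect_type R)) : \bar R := (lam A)%:E.

Lemma lam_content_ge0 A : (0 <= lam_content A)%E.
Proof. by rewrite lee_fin. Qed.

Lemma lam_content_semi_additive : measure_function.semi_additive lam_content.
Proof.
move=> F n _ tF _; rewrite /lam_content.
elim: n => [|n IH]; first by rewrite !big_ord0 lam_set0.
rewrite big_ord_recr/= lamU; first by rewrite EFinD IH big_ord_recr.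
rewrite -bigcup_mkord; apply/seteqP; split => // x [[k /= kn Fk] Fn].
have kn' : k = n by apply: (tF k n I I); exists x.
by move: kn; rewrite kn' ltnn.
Qed.

HB.instance Definition _ := isContent.Build _ _ R lam_content
  lam_content_ge0 lam_content_semi_additive.

(* Inner regularity of the marginals makes rectangles approximable by compact
   rectangles, uniformly over all couplings of [mu] and [nu]. *)
Lemma lam_content_sigma_subadditive :
  measurable_subset_sigma_subadditive lam_content.
Proof.
move=> X F mF [A mA [B mB <-]] XF; apply/lee_addgt0Pr => e e0.
(* Four errors of total size [e / 4] each: the compact approximations of [A] and of [B] from inside,
   and the open enlargements of the first and of the second sides of all the [F n]. *)
have e40 : 0 < e / 4 by rewrite divr_gt0.
have /choice[AB HAB] : forall n, exists AB : set R * set R,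
    [/\ measurable AB.1, measurable AB.2 & F n = AB.1 `*` AB.2].
  by move=> n; have [A' mA' [B' mB' <-]] := mF n; exists (A', B').
have en0 n : 0 < e / 4 / (2 ^ n.+1)%:R by rewrite divr_gt0// ltr0n expn_gt0.
have /choice[U HU] n := outer_open mu (let: And3 h _ _ := HAB n in h) (en0 n).
have /choice[V HV] n := outer_open nu (let: And3 _ h _ := HAB n in h) (en0 n).
have [K [cK KA muK]] := inner_compact mu mA e40.
have [L [cL LB nuL]] := inner_compact nu mB e40.
have mK : measurable K.
  by apply: closed_measurable; apply: compact_closed.
have mL : measurable L.
  by apply: closed_measurable; apply: compact_closed.
have mU n : measurable (U n).
  by apply: open_measurable; have [] := HU n.
have mV n : measurable (V n).
  by apply: open_measurable; have [] := HV n.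
have [N KLN] : exists N, K `*` L `<=` \big[setU/set0]_(i < N) (U i `*` V i).
  have : @cover_compact (R * R)%type (K `*` L).
    exact/compact_coverR2/compact_setX.
  move=> /(_ _ setT (fun n => U n `*` V n)) [|z [Kz Lz]|D _ HD].
  - move=> i _; apply: open_setX; first by have [] := HU i.
    by have [] := HV i.
  - have [|n _] := XF z; first by split; [exact: KA|exact: LB].
    have [_ _ ->] := HAB n => -[Az Bz]; exists n => //; split.
      by have [_ + _] := HU n; exact.
    by have [_ + _] := HV n; exact.
  - exists (\max_(i <- finmap.enum_fset D) i).+1 => z /HD [i /= iD zi].
    rewrite -(bigcup_mkord _ (fun i => U i `*` V i)); exists i => //=.
    by rewrite ltnS; apply: leq_bigmax_seq.
(* Whatever [lam] does inside the plane, enlarging a rectangle adds at most two strips, whose masses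
   are given by the marginals. *)
have step n : lam (U n `*` V n) <= lam (F n) + e / 2 / (2 ^ n.+1)%:R.
  have [mA' mB' ->] := HAB n; set A' := (AB n).1; set B' := (AB n).2.
  apply: (@le_trans _ _ (lam ((A' `*` B') `|` (((U n `\` A') `*` setT) `|`
      (setT `*` (V n `\` B')))))).
    apply: le_lam => -[x y] [/= Ux Vy].
    have [Ax|nAx] := pselect (A' x); last by right; left.
    have [By|nBy] := pselect (B' y); last by right; right.
    by left.
  rewrite (le_trans (le_lamU _ _))// lerD2l (le_trans (le_lamU _ _))//.
  have -> : e / 2 / (2 ^ n.+1)%:R =
      e / 4 / (2 ^ n.+1)%:R + e / 4 / (2 ^ n.+1)%:R :> R by field.
  apply: lerD; rewrite -lee_fin.
    rewrite lam_fst; last exact: measurableD.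
    by apply: ltW; have [] := HU n.
  rewrite lam_snd; last exact: measurableD.
  by apply: ltW; have [] := HV n.
have main : lam (A `*` B) <=
    \sum_(i < N) (lam (F i) + e / 2 / (2 ^ i.+1)%:R) + e / 2.
  apply: (@le_trans _ _ (lam ((K `*` L) `|` (((A `\` K) `*` setT) `|`
      (setT `*` (B `\` L)))))).
    apply: le_lam => -[x y] [/= Ux Vy].
    have [Ax|nAx] := pselect (K x); last by right; left.
    have [By|nBy] := pselect (L y); last by right; right.
    by left.
  rewrite (le_trans (le_lamU _ _))//; apply: lerD.
    apply: le_trans (le_lam KLN) _.
    rewrite (le_trans (lam_bigsetU (fun i => U i `*` V i) _))//.
    by apply: ler_sum => i _; exact: step.
  rewrite (le_trans (le_lamU _ _))//.
  have -> : e / 2 = e / 4 + e / 4 by field.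
  apply: lerD; rewrite -lee_fin.
    by rewrite lam_fst; [exact: ltW|exact: measurableD].
  by rewrite lam_snd; [exact: ltW|exact: measurableD].
rewrite /lam_content; apply: (@le_trans _ _
    (\sum_(i < N) (lam_content (F i) + (e / 2 / (2 ^ i.+1)%:R)%:E) + (e / 2)%:E)%E).
  by rewrite sumEFin -EFinD lee_fin.
have -> : (e%:E = (e / 2)%:E + (e / 2)%:E)%E by rewrite -EFinD -splitr.
rewrite addeA leeD2r//.
apply: le_trans; last first.
  apply: (@epsilon_trick _ (lam_content \o F) (e / 2) xpredT).
    by move=> n; exact: lam_content_ge0.
  by rewrite ltW// divr_gt0.
rewrite -(big_mkord xpredT (fun i => lam_content (F i) + (e / 2 / (2 ^ i.+1)%:R)%:E)%E).
apply: nneseries_lim_ge => n _ _.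
by rewrite adde_ge0 ?lam_content_ge0// lee_fin divr_ge0// divr_ge0// ltW.
Qed.

HB.instance Definition _ := Content_SigmaSubAdditive_isMeasure.Build _ _ _
  lam_content lam_content_sigma_subadditive.

Definition coupling_of : set (R * R) -> \bar R := measure_extension lam_content.

Lemma measurable_rect (X : set (R * R)) :
  measurable X = (@measurable _ (rect_type R)).-sigma.-measurable X.
Proof. by rewrite measurable_prod_measurableType. Qed.

Lemma coupling_of0 : coupling_of set0 = 0%E.
Proof. exact: measure0. Qed.

Lemma coupling_of_ge0 X : (0 <= coupling_of X)%E.
Proof. exact: measure_ge0. Qed.

Lemma coupling_of_sigma_additive : semi_sigma_additive coupling_of.
Proof.
move=> F mF tF mUF.
apply: (@measure_semi_sigma_additive _ _ _ (measure_extension lam_content)) => //.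
  by move=> i; rewrite -measurable_rect.
by rewrite -measurable_rect.
Qed.

HB.instance Definition _ := isMeasure.Build _ _ _ coupling_of
  coupling_of0 coupling_of_ge0 coupling_of_sigma_additive.

Lemma coupling_ofE A B : measurable A -> measurable B ->
  coupling_of (A `*` B) = (lam (A `*` B))%:E.
Proof.
move=> mA mB; rewrite /coupling_of /measure_extension measurable_mu_extE//=.
by exists A => //; exists B.
Qed.

Lemma coupling_of_setT : coupling_of setT = 1%E.
Proof. by rewrite -setXTT coupling_ofE// lam_fst// probability_setT. Qed.

HB.instance Definition _ := Measure_isProbability.Build _ _ _ coupling_of
  coupling_of_setT.

(** A finitely additive set function with countably additive marginals thus induces a true measure,
    tied to [lam] through its values on rectangles. *)
Lemma exists_coupling : exists P : probability (R * R)%type R,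
  forall A B, measurable A -> measurable B -> P (A `*` B) = (lam (A `*` B))%:E.
Proof. by exists coupling_of => A B; exact: coupling_ofE. Qed.

End bimeasure.

(** * Hahn-Banach theorem for bounded functions *)

Section bounded_functions.
Variables (T : Type) (R : realType).
Implicit Types v w : T -> R.

Definition bdd v := exists M, forall z, `|v z| <= M.

Lemma bddD v w : bdd v -> bdd w -> bdd (fun z => v z + w z).
Proof.
move=> [M vM] [N wN]; exists (M + N) => z.
by rewrite (le_trans (ler_normD _ _))// lerD.
Qed.

Lemma bddZ a v : bdd v -> bdd (fun z => a * v z).
Proof. by move=> [M vM]; exists (`|a| * M) => z; rewrite normrM ler_wpM2l. Qed.

Lemma bddM v w : bdd v -> bdd w -> bdd (fun z => v z * w z).
Proof.
by move=> [M vM] [N wN]; exists (M * N) => z; rewrite normrM ler_pM.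
Qed.

Lemma bddN v : bdd v -> bdd (fun z => - v z).
Proof. by move=> [M vM]; exists M => z; rewrite normrN. Qed.

Lemma bddB v w : bdd v -> bdd w -> bdd (fun z => v z - w z).
Proof. by move=> bv bw; apply: bddD => //; exact: bddN. Qed.

Lemma bdd_cst a : bdd (fun=> a).
Proof. by exists `|a|. Qed.

End bounded_functions.

Section sublinear.
Variables (T : Type) (R : realType).
Implicit Types (v w : T -> R) (p q : (T -> R) -> R).

(** Functions are total, but only bounded ones count as vectors, hence the guards; values at
    unbounded functions are left unconstrained. *)
Definition sublinear p :=
  [/\ p (fun=> 0) = 0,
      forall v w, bdd v -> bdd w -> p (fun z => v z + w z) <= p v + p w &
      forall a v, 0 < a -> bdd v -> p (fun z => a * v z) <= a * p v].

Lemma sublinearZ p a v : sublinear p -> 0 <= a -> bdd v ->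
  p (fun z => a * v z) = a * p v.
Proof.
move=> [p0 _ pZ]; rewrite le_eqVlt => /predU1P[<- _|a0 bv].
  by rewrite mul0r -[RHS]p0; congr p; apply/funext => z; rewrite mul0r.
apply/eqP; rewrite eq_le pZ//=.
rewrite -ler_pdivlMl//.
have := pZ a^-1 (fun z => a * v z); rewrite invr_gt0 a0 => /(_ isT (bddZ a bv)).
apply: le_trans; rewrite le_eqVlt; apply/orP; left; apply/eqP; congr p.
by apply/funext => z; rewrite mulrA mulVf ?gt_eqF// mul1r.
Qed.

Lemma sublinear_ge p v : sublinear p -> bdd v -> - p (fun z => - v z) <= p v.
Proof.
move=> [p0 pD _] bv; rewrite -subr_ge0 opprK addrC -[leLHS]p0.
have := pD _ _ (bddN bv) bv; apply: le_trans.
rewrite le_eqVlt; apply/orP; left; apply/eqP; congr p.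
by apply/funext => z; rewrite addNr.
Qed.

Section inf.
Variables (I : Type) (A : set I) (F : I -> (T -> R) -> R).
Hypotheses (A0 : A !=set0)
  (lbF : forall v, bdd v -> exists m, forall i, A i -> m <= F i v).

Let q v := inf [set F i v | i in A].

Lemma infF_le i v : A i -> bdd v -> q v <= F i v.
Proof.
move=> Ai bv; apply: ge_inf; last by exists i.
by have [m mF] := lbF bv; exists m => _ [j Aj <-]; exact: mF.
Qed.

Lemma infF_ge v m : (forall i, A i -> m <= F i v) -> m <= q v.
Proof.
move=> mF; apply: lb_le_inf; first by have [i Ai] := A0; exists (F i v); exists i.
by move=> _ [i Ai <-]; exact: mF.
Qed.

(** Letting the index [k] depend on both arguments covers two uses: a chain, where the smaller of
    two functionals serves, and a family indexed by [t >= 0], where indices add up and scale. *)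
Lemma sublinear_inf :
  (forall i, A i -> F i (fun=> 0) = 0) ->
  (forall i j v w, A i -> A j -> bdd v -> bdd w ->
    exists2 k, A k & F k (fun z => v z + w z) <= F i v + F j w) ->
  (forall i a v, A i -> 0 < a -> bdd v ->
    exists2 k, A k & F k (fun z => a * v z) <= a * F i v) ->
  sublinear q.
Proof.
move=> F0 FD FZ; split.
- have [i Ai] := A0; apply/eqP; rewrite eq_le; apply/andP; split.
    by rewrite -[leRHS](F0 _ Ai) infF_le//; exact: bdd_cst.
  by apply: infF_ge => j Aj; rewrite F0.
- move=> v w bv bw; rewrite -lerBlDr; apply: infF_ge => i Ai.
  rewrite lerBlDr -lerBlDl; apply: infF_ge => j Aj; rewrite lerBlDl.
  have [k Ak] := FD i j v w Ai Aj bv bw; apply: le_trans.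
  by apply: infF_le => //; exact: bddD.
- move=> a v a0 bv; rewrite -ler_pdivrMl//; apply: infF_ge => i Ai.
  rewrite ler_pdivrMl//; have [k Ak] := FZ i a v Ai a0 bv; apply: le_trans.
  by apply: infF_le => //; exact: bddZ.
Qed.

End inf.

(* A minimal sublinear functional is linear, so Zorn's lemma yields a
   Hahn-Banach theorem without extending partial functionals. *)
Lemma sublinear_minorant p : sublinear p ->
  exists f, [/\ forall v w, bdd v -> bdd w -> f (fun z => v z + w z) = f v + f w,
    forall a v, bdd v -> f (fun z => a * v z) = a * f v &
    forall v, bdd v -> f v <= p v].
Proof.
move=> psub.
pose Q := {q : (T -> R) -> R | sublinear q /\ forall v, bdd v -> q v <= p v}.
pose q0 : Q := exist _ p (conj psub (fun v _ => lexx (p v))).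
(* The order is reversed, so a maximal element for Zorn's lemma is a minimal sublinear
   functional. *)
pose r (q1 q2 : Q) := `[< forall v, bdd v -> sval q2 v <= sval q1 v >].
have [|||[m [msub mp]] mmin] := @ZL_preorder Q q0 r.
- by move=> q; apply/asboolP => v _.
- move=> q1 q2 q3 /asboolP h12 /asboolP h23; apply/asboolP => v bv.
  exact: le_trans (h23 _ bv) (h12 _ bv).
- move=> A Atot; have [A0|nA0] := pselect (A !=set0); last first.
    by exists q0 => s As; case: nA0; exists s.
  have lbA v : bdd v -> exists m, forall s : Q, A s -> m <= sval s v.
    move=> bv; exists (- p (fun z => - v z)) => -[q [qs qp]] _ /=.
    apply: le_trans (sublinear_ge qs bv); rewrite lerN2 qp//; exact: bddN.
  have qs : sublinear (fun v => inf [set sval s v | s in A]).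
    apply: (sublinear_inf (F := fun s : Q => sval s) A0 lbA).
    - by move=> [q [[]]].
    - move=> q1 q2 v w A1 A2 bv bw; have [/asboolP h|/asboolP h] := Atot _ _ A1 A2.
        exists q2 => //; have [[_ qD _] _] := svalP q2.
        by rewrite (le_trans (qD _ _ bv bw))// lerD2r h.
      exists q1 => //; have [[_ qD _] _] := svalP q1.
      by rewrite (le_trans (qD _ _ bv bw))// lerD2l h.
    - move=> q a v Aq a0 bv; exists q => //.
      by have [[_ _ qZ] _] := svalP q; exact: qZ.
  have qp v : bdd v -> inf [set sval s v | s in A] <= p v.
    move=> bv; have [q Aq] := A0; apply: le_trans (infF_le (F := fun s : Q => sval s) lbA Aq bv) _.
    by have [_] := svalP q; exact.
  pose QP q := sublinear q /\ forall v, bdd v -> q v <= p v.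
  exists (exist QP _ (conj qs qp)) => q Aq; apply/asboolP => v bv /=.
  exact: (infF_le (F := fun s : Q => sval s) lbA Aq bv).
have [m0 mD mZ] := msub.
have madd v w : bdd v -> bdd w -> m (fun z => v z + w z) = m v + m w.
  move=> bv bw; apply/eqP; rewrite eq_le mD//=.
  (* The infimum over [t >= 0] is a sublinear functional below [m], so minimality puts [m] below it;
     the term at [t = 1] then yields [m w + m v <= m (w + v)]. *)
  pose F (t : R) w := m (fun z => w z + t * v z) - t * m v.
  pose A := [set t : R | 0 <= t].
  have A0 : A !=set0 by exists 0; rewrite /A /=.
  have lbF u : bdd u -> exists l, forall t, A t -> l <= F t u.
    move=> bu; exists (- m (fun z => - u z)) => t t0.
    rewrite /F lerBrDr addrC -lerBrDr opprK -(sublinearZ msub)//.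
    apply: le_trans (mD _ _ _ _); last 2 first.
    - by apply: bddD => //; exact: bddZ.
    - exact: bddN.
    rewrite le_eqVlt; apply/orP; left; apply/eqP; congr m.
    by apply/funext => z; rewrite addrAC subrr add0r.
  have Fs : sublinear (fun u => inf [set F t u | t in A]).
    apply: (sublinear_inf A0 lbF).
    - move=> t At; rewrite /F (_ : (fun z => _) = (fun z => t * v z)); last first.
        by apply/funext => z; rewrite add0r.
      by rewrite sublinearZ// subrr.
    - move=> s t u u' As At bu bu'; exists (s + t); first exact: addr_ge0.
      rewrite /F mulrDl opprD addrACA lerD2r.
      apply: le_trans (mD _ _ _ _); [|exact/bddD/bddZ|exact/bddD/bddZ].
      rewrite le_eqVlt; apply/orP; left; apply/eqP; congr m.
      by apply/funext => z; rewrite mulrDl addrACA.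
    - move=> t a u At a0 bu; exists (a * t); first by rewrite /A /= mulr_ge0// ltW.
      rewrite /F mulrBr mulrA lerD2r.
      apply: le_trans (mZ _ _ a0 _); last exact/bddD/bddZ.
      rewrite le_eqVlt; apply/orP; left; apply/eqP; congr m.
      by apply/funext => z; rewrite mulrDr mulrA.
  have Fm u : bdd u -> inf [set F t u | t in A] <= m u.
    move=> bu; have : F 0 u = m u.
      rewrite /F mul0r subr0; congr m; apply/funext => z; by rewrite mul0r addr0.
    by move=> <-; apply: (infF_le lbF) => //; rewrite /A /=.
  have Fp u : bdd u -> inf [set F t u | t in A] <= p u.
    by move=> bu; rewrite (le_trans (Fm _ bu))// mp.
  pose QP q := sublinear q /\ forall v, bdd v -> q v <= p v.
  have /asboolP/= := mmin (exist QP _ (conj Fs Fp)) (asboolT Fm).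
  move=> /(_ w bw) h; rewrite -lerBrDl; apply: le_trans h _.
  apply: le_trans (infF_le lbF (_ : A 1) bw) _; first by rewrite /A /=.
  rewrite /F mul1r lerD2r le_eqVlt; apply/orP; left; apply/eqP; congr m.
  by apply/funext => z; rewrite mul1r addrC.
exists m; split => // a v bv.
have [a0|a0] := leP 0 a; first exact: sublinearZ.
have mN u : bdd u -> m (fun z => - u z) = - m u.
  move=> bu; apply/eqP; rewrite -addr_eq0 -madd//; last exact: bddN.
  by rewrite -[X in _ == X]m0; apply/eqP; congr m; apply/funext => z; rewrite addNr.
have -> : (fun z => a * v z) = (fun z => - ((- a) * v z)).
  by apply/funext => z; rewrite mulNr opprK.
rewrite mN; last exact: bddZ.
by rewrite sublinearZ// ?oppr_ge0 1?ltW// mulNr opprK.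
Qed.

End sublinear.

(** * Integrals of bounded measurable functions *)

Section bounded_measurable.
Context d (T : measurableType d) (R : realType).
Implicit Types (f g : T -> R) (m : probability T R).

Definition bm f := measurable_fun setT f /\ bdd f.

Lemma bmD f g : bm f -> bm g -> bm (fun x => f x + g x).
Proof. by move=> [mf bf] [mg bg]; split; [exact: measurable_funD|exact: bddD]. Qed.

Lemma bmB f g : bm f -> bm g -> bm (fun x => f x - g x).
Proof. by move=> [mf bf] [mg bg]; split; [exact: measurable_funB|exact: bddB]. Qed.

Lemma bmM f g : bm f -> bm g -> bm (fun x => f x * g x).
Proof. by move=> [mf bf] [mg bg]; split; [exact: measurable_funM|exact: bddM]. Qed.

Lemma bm_cst a : bm (fun=> a).
Proof. by split; [exact: measurable_cst|exact: bdd_cst]. Qed.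

Lemma bmZ a f : bm f -> bm (fun x => a * f x).
Proof. by apply: bmM; exact: bm_cst. Qed.

Lemma bmN f : bm f -> bm (fun x => - f x).
Proof. by move=> [mf bf]; split; [exact: measurable_funN|exact: bddN]. Qed.

Lemma bm_indic A : measurable A -> bm (\1_A : T -> R).
Proof.
move=> mA; split; first exact: measurable_indic.
by exists 1 => x; rewrite indicE; case: (_ \in _); rewrite ?normr0 ?normr1.
Qed.

Lemma bm_sum (I : Type) (s : seq I) (F : I -> T -> R) :
  (forall i, bm (F i)) -> bm (fun x => \sum_(i <- s) F i x).
Proof.
move=> bF; elim: s => [|i s IH].
  by under eq_fun do rewrite big_nil; exact: bm_cst.
by under eq_fun do rewrite big_cons; exact: bmD.
Qed.

Lemma bm_integrable m f : bm f -> m.-integrable setT (EFin \o f).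
Proof.
move=> [mf [M fM]]; apply: measurable_bounded_integrable => //.
  by rewrite -ge0_fin_numE ?fin_num_measure.
exists M; split; first exact: num_real.
by move=> x Mx y _; exact: le_trans (fM y) (ltW Mx).
Qed.

Lemma bm_integralE m f : bm f ->
  (\int[m]_x (f x)%:E)%E = (\int[m]_x f x)%:E.
Proof.
by move=> bf; rewrite fineK//; apply: integrable_fin_num => //;
  exact: bm_integrable.
Qed.

Lemma bm_intD m f g : bm f -> bm g ->
  \int[m]_x (f x + g x) = \int[m]_x f x + \int[m]_x g x.
Proof. by move=> bf bg; rewrite RintegralD//; exact: bm_integrable. Qed.

Lemma bm_intB m f g : bm f -> bm g ->
  \int[m]_x (f x - g x) = \int[m]_x f x - \int[m]_x g x.
Proof. by move=> bf bg; rewrite RintegralB//; exact: bm_integrable. Qed.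

Lemma bm_intZ m a f : bm f -> \int[m]_x (a * f x) = a * \int[m]_x f x.
Proof. by move=> bf; rewrite RintegralZl//; exact: bm_integrable. Qed.

Lemma bm_int_le m f g : bm f -> bm g -> (forall x, f x <= g x) ->
  \int[m]_x f x <= \int[m]_x g x.
Proof. by move=> bf bg fg; apply: le_Rintegral => //; exact: bm_integrable. Qed.

Lemma int_cst m a : \int[m]_x a = a.
Proof. by rewrite Rintegral_cst//= (_ : _ setT = 1%E) ?mulr1//;
  exact: probability_setT. Qed.

Lemma int_indic m A : measurable A -> \int[m]_x \1_A x = fine (m A).
Proof. by move=> mA; rewrite /Rintegral integral_indic// setIT. Qed.

Lemma bm_int_sum m n (F : nat -> T -> R) : (forall i, bm (F i)) ->
  \int[m]_x (\sum_(i < n) F i x) = \sum_(i < n) \int[m]_x F i x.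
Proof.
move=> bF; elim: n => [|n IH].
  by rewrite big_ord0; under eq_Rintegral do rewrite big_ord0; rewrite int_cst.
rewrite big_ord_recr/= -IH -bm_intD//; last exact: bm_sum.
by congr (Rintegral _ _ _); apply/funext => x; rewrite big_ord_recr.
Qed.

Lemma bm_max f g : bm f -> bm g -> bm (fun x => Num.max (f x) (g x)).
Proof.
move=> [mf [M fM]] [mg [N gN]]; split; first exact: measurable_maxr.
exists (Num.max M N) => x; rewrite le_max.
by have [_|_] := leP (f x) (g x); rewrite ?fM ?gN ?orbT.
Qed.

Lemma bm_int_ae_eq m f g : bm f -> bm g -> {ae m, forall x, f x = g x} ->
  \int[m]_x f x = \int[m]_x g x.
Proof.
move=> [mf _] [mg _] fg; rewrite /Rintegral; congr fine.
apply: ae_eq_integral => //; [exact/measurable_EFinP|exact/measurable_EFinP|].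
by apply: filterS fg => x /= -> _.
Qed.

Lemma bm_int_ae_le m f g : bm f -> bm g -> {ae m, forall x, f x <= g x} ->
  \int[m]_x f x <= \int[m]_x g x.
Proof.
(* Replacing [g] by [max f g], which equals it a.e., makes the comparison pointwise. *)
move=> bf bg fg; have -> : \int[m]_x g x = \int[m]_x Num.max (f x) (g x).
  apply: bm_int_ae_eq => //; first exact: bm_max.
  by apply: filterS fg => x /= fgx; rewrite max_r.
by apply: bm_int_le => // [|x]; [exact: bm_max|rewrite le_max lexx].
Qed.

Lemma bm_int_le0 m f : bm f -> (forall x, 0 <= f x) -> \int[m]_x f x <= 0 ->
  {ae m, forall x, f x = 0}.
Proof.
move=> bf f0 int0.
have : (\int[m]_x `|(f x)%:E| = 0)%E.
  under eq_integral do rewrite gee0_abs ?lee_fin//.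
  apply/eqP; rewrite bm_integralE// eqe eq_le int0/=.
  by apply: Rintegral_ge0 => x _.
have mf : measurable_fun setT (EFin \o f) by apply/measurable_EFinP; case: bf.
move=> /(ae_eq_integral_abs m measurableT mf); apply: filterS => x /= h.
by have [] := h I.
Qed.

Lemma bm_approx f e : bm f -> 0 < e ->
  exists n (a : nat -> R) (A : nat -> set T), (forall i, measurable (A i)) /\
    forall x, `|f x - \sum_(i < n) a i * \1_(A i) x| <= e.
Proof.
move=> [mf [M fM]] e0.
(* Layer cake: [f + M] is nonnegative, and adding [e] for each level [i * e] that it reaches rounds
   it down to a multiple of [e]. In the witnesses below, index 0 carries the constant [- M], and the
   levels go beyond [2 M], which [f + M] never exceeds. *)
pose B i := [set x | i%:R * e <= f x + M].
have mB i : measurable (B i).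
  rewrite (_ : B i = f @^-1` `[i%:R * e - M, +oo[%classic); last first.
    by apply/seteqP; split => x; rewrite /B /= in_itv/= andbT lerBlDr.
  by rewrite -[X in measurable X]setTI; apply: mf => //; exact: measurable_itv.
pose S n x := \sum_(i < n) e * \1_(B i.+1) x.
have Sn n x : if n%:R * e <= f x + M then S n x = n%:R * e
    else S n x <= f x + M /\ f x + M - e <= S n x.
  have t0 : 0 <= f x + M.
    by move: (fM x); rewrite ler_norml => /andP[];
      rewrite addrC -subr_ge0 opprK addrC.
  elim: n => [|n]; first by rewrite mul0r t0 /S big_ord0.
  rewrite /S big_ord_recr/= -/(S n x) indicE.
  have h : n.+1%:R * e = n%:R * e + e by rewrite -natr1 mulrDl mul1r.
  have -> : (x \in B n.+1) = (n.+1%:R * e <= f x + M).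
    by apply/idP/idP => [/set_mem//|H]; exact/mem_set.
  case: (boolP (n.+1%:R * e <= f x + M)) => le1; case: ifPn => le2.
  - by move=> ->; rewrite mulr1 h.
  - by move: le1 le2; rewrite h -!ltNge => ? ? _; lra.
  - by move: le1; rewrite -ltNge h => ? ->; rewrite mulr0 addr0; split; lra.
  - by rewrite mulr0 addr0.
exists (Num.truncn (M *+ 2 / e)).+2, (fun i => if i is 0 then - M else e), (fun i => if i is 0 then setT else B i).
split => [[|i]//|x].
rewrite big_ord_recl/= indicE in_setT mulr1.
have := Sn (Num.truncn (M *+ 2 / e)).+1 x; rewrite /S.
under eq_bigr do rewrite /bump /= add1n.
set N := _.+1; have MN : M *+ 2 < N%:R * e.
  by rewrite -ltr_pdivrMr// truncnS_gt.
have := fM x; rewrite ler_norml => /andP[? ?].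
rewrite ifF; last by apply/negbTE; rewrite -ltNge; lra.
by move=> [? ?]; rewrite ler_norml; apply/andP; split; lra.
Qed.

End bounded_measurable.

(** * Lipschitz functions and projection onto an interval *)

Section lipschitz.
Variable R : realType.
Implicit Types f g : R -> R.

Definition lipf f := exists M, forall x y, `|f x - f y| <= M * `|x - y|.

Lemma lipfD f g : lipf f -> lipf g -> lipf (fun x => f x + g x).
Proof.
move=> [M fM] [N gN]; exists (M + N) => x y.
rewrite opprD addrACA mulrDl (le_trans (ler_normD _ _))//.
by rewrite lerD.
Qed.

Lemma lipfZ a f : lipf f -> lipf (fun x => a * f x).
Proof.
move=> [M fM]; exists (`|a| * M) => x y.
by rewrite -mulrBr normrM -mulrA ler_wpM2l.
Qed.

Lemma lipfN f : lipf f -> lipf (fun x => - f x).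
Proof. by move=> [M fM]; exists M => x y; rewrite -opprD normrN. Qed.

Lemma lipfB f g : lipf f -> lipf g -> lipf (fun x => f x - g x).
Proof. by move=> lf lg; apply: lipfD => //; exact: lipfN. Qed.

Lemma lipf_cst a : lipf (fun=> a).
Proof. by exists 0 => x y; rewrite subrr normr0 mul0r. Qed.

Lemma lipf_id : lipf (fun x => x).
Proof. by exists 1 => x y; rewrite mul1r. Qed.

Lemma lipf_continuous f : lipf f -> continuous f.
Proof.
move=> [M fM] x; apply/cvgrPdist_le => e e0; near=> y.
apply: le_trans (fM x y) _.
apply: (@le_trans _ _ ((`|M| + 1) * `|x - y|)).
  by rewrite ler_wpM2r// (le_trans (ler_norm _))// lerDl.
rewrite -ler_pdivlMl ?ltr_wpDl//.
near: y; apply: cvgr_dist_le => //.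
by rewrite mulr_gt0// invr_gt0 ltr_wpDl.
Unshelve. all: by end_near. Qed.

Lemma lipf_measurable f : lipf f -> measurable_fun setT f.
Proof. by move=> /lipf_continuous; exact: continuous_measurable_fun. Qed.

Lemma max_lip (a x y : R) : `|Num.max a x - Num.max a y| <= `|x - y|.
Proof.
rewrite /Num.max; case: ltP => ax; case: ltP => ay //; rewrite ?subrr ?normr0//.
- by rewrite !ger0_norm ?subr_ge0 ?(ltW ax)//; lra.
- by rewrite distrC (distrC x) !ger0_norm ?subr_ge0 ?(ltW ay)//; lra.
Qed.

Lemma min_lip (a x y : R) : `|Num.min x a - Num.min y a| <= `|x - y|.
Proof.
rewrite /Num.min; case: ltP => ax; case: ltP => ay //; rewrite ?subrr ?normr0//.
- by rewrite distrC (distrC x) !ger0_norm ?subr_ge0 ?(ltW ax)//; lra.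
- by rewrite !ger0_norm ?subr_ge0 ?(ltW ay)//; lra.
Qed.

Lemma closed_forall_le0 (I : Type) (G : I -> R -> R) :
  (forall i, lipf (G i)) -> closed [set x | forall i, G i x <= 0].
Proof.
move=> lG; rewrite (_ : [set x | _] = \bigcap_(i in setT) (G i @^-1` [set y | y <= 0])).
  apply: closed_bigI => i _; apply: closed_comp; last exact: closed_le.
  by move=> x _; exact: lipf_continuous.
by apply/seteqP; split => x /= h i; [move=> _; exact: h|exact: h].
Qed.

End lipschitz.

Section clamp.
Variables (R : realType) (l r : R).
Hypothesis lr : l <= r.

(** Nearest-point projection onto [[l, r]]. Composing with it turns functions on the interval into
    total functions on the line with the same Lipschitz constant. *)
Definition clamp x := Num.max l (Num.min x r).

Lemma clamp_itv x : l <= clamp x <= r.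
Proof. by rewrite /clamp le_max lexx/= ge_max lr/= ge_min lexx orbT. Qed.

Lemma clamp_id x : l <= x <= r -> clamp x = x.
Proof. by move=> /andP[lx xr]; rewrite /clamp min_l// max_r. Qed.

Lemma clampK x : clamp (clamp x) = clamp x.
Proof. by rewrite clamp_id// clamp_itv. Qed.

Lemma clamp_lip x y : `|clamp x - clamp y| <= `|x - y|.
Proof. by rewrite /clamp (le_trans (max_lip _ _ _))// min_lip. Qed.

Lemma lipf_clamp : lipf clamp.
Proof. by exists 1 => x y; rewrite mul1r clamp_lip. Qed.

Lemma clamp_dist x y : `|clamp x - clamp y| <= r - l.
Proof.
have := clamp_itv x; have := clamp_itv y => /andP[? ?] /andP[? ?].
by rewrite ler_norml; apply/andP; split; lra.
Qed.

End clamp.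

(** * The relaxed dual problem *)

Section transform.
Variables (R : realType) (l r L H : R) (C : R -> R -> R).
Hypotheses (lr : l <= r) (L0 : 0 <= L) (H0 : 0 <= H)
  (CL : forall x y x' y', `|C x y - C x' y'| <= L * (`|x - x'| + `|y - y'|))
  (Cp : forall x y, C x y = C (clamp l r x) (clamp l r y)).
Local Notation pi := (clamp l r).
Implicit Types (g : R -> R) (x y a k e : R).

(** [H + L] is the Lipschitz constant inherited by an infimum over [x] of
    [f x + h x * (y - x) + C x y] with [|h| <= H]: [H] from the multiplier and [L] from the cost. *)
Definition potential g :=
  (forall x y, `|g x - g y| <= (H + L) * `|x - y|) /\ forall x, g (pi x) = g x.

Definition tangent g x a k :=
  - H <= k <= H /\ forall y, g y - C x y <= a + k * (pi y - pi x).

(* [H]-Lipschitz concave envelope of [g - C x] on [l, r], at the point [x] *)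
Definition envelope g x := inf [set a | exists k, tangent g x a k].

(** The least slope, at least [- H], whose line through the envelope value at [x] dominates
    [g - C x] to the right of [x]. Writing the points to the right as [max (pi x) (pi y)], instead
    of restricting [y], makes each constraint Lipschitz in [x]; measurability rests on this. *)
Definition slope g x := inf [set k | - H <= k /\
  forall y, g (Num.max (pi x) (pi y)) - C x (Num.max (pi x) (pi y)) - envelope g x
    <= k * (Num.max (pi x) (pi y) - pi x)].

Lemma tangent_ge g x a k : tangent g x a k -> g x - C x x <= a.
Proof. by move=> [_ /(_ x)]; rewrite subrr mulr0 addr0. Qed.

Lemma tangent_le g x a b k : a <= b -> tangent g x a k -> tangent g x b k.
Proof. by move=> ab [kH h]; split => // y; rewrite (le_trans (h y))// lerD2r. Qed.

Lemma potential_drift g x y : potential g ->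
  `|g y - C x y - (g x - C x x)| <= (H + L + L) * `|pi y - pi x|.
Proof.
move=> [gL gp]; rewrite -(gp y) -(gp x) (Cp x y) (Cp x x) opprD opprK addrACA.
rewrite (le_trans (ler_normD _ _))// mulrDl lerD ?gL//.
rewrite addrC distrC (distrC (pi y)) [leLHS]distrC.
by rewrite (le_trans (CL _ _ _ _))// subrr normr0 add0r.
Qed.

Lemma tangent_ex g x : potential g ->
  tangent g x (g x - C x x + (H + L + L) * (r - l)) 0.
Proof.
move=> pg; split => [|y]; first by rewrite oppr_le0 H0.
rewrite mul0r addr0 -lerBlDl (le_trans (ler_norm _))//.
rewrite (le_trans (potential_drift _ _ pg))// ler_wpM2l ?addr_ge0//.
exact: clamp_dist.
Qed.

Lemma envelope_ge g x b : potential g ->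
  (forall a k, tangent g x a k -> b <= a) -> b <= envelope g x.
Proof.
move=> pg h; apply: lb_le_inf; first by eexists; exists 0; exact: tangent_ex.
by move=> a [k ak]; exact: h ak.
Qed.

Lemma envelope_le g x a k : tangent g x a k -> envelope g x <= a.
Proof.
move=> ak; apply: ge_inf; last by exists k.
by exists (g x - C x x) => b [k' /tangent_ge].
Qed.

Lemma envelope_adherent g x e : potential g -> 0 < e ->
  exists k, tangent g x (envelope g x + e) k.
Proof.
move=> pg e0; have [] := @inf_adherent _ [set a | exists k, tangent g x a k] e e0.
  split; first by eexists; exists 0; exact: tangent_ex.
  by exists (g x - C x x) => b [k' /tangent_ge].
by move=> a [k ak] ae; exists k; apply: tangent_le ak; exact: ltW.
Qed.

Lemma potential_max g x y : potential g -> pi x <= pi y ->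
  [/\ Num.max (pi x) (pi y) = pi y, g (pi y) = g y & C x (pi y) = C x y].
Proof.
move=> [_ gp] xy; split => //; first by rewrite max_r.
by rewrite Cp clampK// -Cp.
Qed.

Lemma potential_clamp_max g x y : potential g ->
  exists z, [/\ pi x <= pi z, Num.max (pi x) (pi y) = pi z,
    g (Num.max (pi x) (pi y)) = g z & C x (Num.max (pi x) (pi y)) = C x z].
Proof.
move=> pg; have [xy|yx] := leP (pi x) (pi y).
  by exists y; have [_ -> ->] := potential_max pg xy.
by exists x; have [_ -> ->] := potential_max pg (lexx (pi x)).
Qed.

Let slopes g x := [set k | - H <= k /\
  forall y, g (Num.max (pi x) (pi y)) - C x (Num.max (pi x) (pi y)) - envelope g x
    <= k * (Num.max (pi x) (pi y) - pi x)].

Lemma slopesP g x k : potential g -> slopes g x k <->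
  - H <= k /\ forall y, pi x <= pi y ->
    g y - C x y - envelope g x <= k * (pi y - pi x).
Proof.
move=> pg; split => -[kH h]; split => // y.
  by move=> xy; have := h y; have [-> -> ->] := potential_max pg xy.
by have [z [xz -> -> ->]] := potential_clamp_max x y pg; exact: h.
Qed.

(** The infimum defining the envelope is attained. An approximate tangent has a single slope serving
    both sides of [x], so every slope needed on the right lies below every slope allowed on the
    left; the least slope needed on the right therefore works on both sides. *)
Lemma slope_tangent g x : potential g ->
  tangent g x (envelope g x) (slope g x).
Proof.
move=> pg; set f := envelope g x.
have adh e : 0 < e -> exists k, tangent g x (f + e) k by exact: envelope_adherent.
have AH : slopes g x H.
  apply/slopesP => //; split; first by rewrite (le_trans _ H0)// oppr_le0.
  move=> y xy; apply/ler_addgt0Pr => e e0;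
    have [k [/andP[_ kH] /(_ y)]] := adh e e0.
  rewrite -lerBlDl opprD addrA => h; rewrite -lerBlDr; apply: le_trans h _.
  by rewrite ler_wpM2r// subr_ge0.
have A0 : slopes g x !=set0 by exists H.
have lbA : lbound (slopes g x) (- H) by move=> k [].
have slopeH : - H <= slope g x by apply: lb_le_inf.
have slope_le k : slopes g x k -> slope g x <= k.
  by move=> Ak; apply: ge_inf => //; exists (- H).
split; first by rewrite slopeH slope_le.
move=> y; rewrite -lerBlDl.
have [xy|yx] := leP (pi x) (pi y).
  move: (xy); rewrite le_eqVlt => /predU1P[e|xy'].
    have /(slopesP _ _ pg)[_ /(_ y xy)] := AH.
    by rewrite -e subrr !mulr0.
  rewrite -ler_pdivrMr ?subr_gt0//; apply: lb_le_inf => // k.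
  move=> /(slopesP _ _ pg)[_ /(_ y xy)].
  by rewrite ler_pdivrMr ?subr_gt0.
set D := pi x - pi y; have D0 : 0 < D by rewrite subr_gt0.
have -> : pi y - pi x = - D by rewrite opprB.
(* The largest slope for which the line of height [f] at [x] still passes above the value at [y], to
   the left of [x]; it remains to show that this slope suffices on the right. *)
pose b := (f - (g y - C x y)) / D.
suff : slope g x <= b by rewrite /b ler_pdivlMr// => ?; lra.
apply/slope_le/slopesP => //; split.
  rewrite /b ler_pdivlMr// -subr_ge0; apply/ler_addgt0Pr => e e0.
  have [k [/andP[kH _] /(_ y)]] := adh e e0.
  have -> : pi y - pi x = - D by rewrite opprB.
  have : - H * D <= k * D by rewrite ler_wpM2r// ltW.
  by rewrite mulrN; lra.
move=> q xq; set D' := pi q - pi x; have D'0 : 0 <= D' by rewrite subr_ge0.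
apply/ler_addgt0Pr => e e0.
(* Chosen so that the error [e'] at [x] and its effect [e' / D * D'] through the slope add up to
   [e]. *)
pose e' := e / (1 + D' / D).
have c0 : 0 < 1 + D' / D by rewrite ltr_pwDl// divr_ge0// ltW.
have e'0 : 0 < e' by rewrite divr_gt0.
have [k [_ h]] := adh e' e'0; have hq := h q; have hy := h y.
have : k <= b + e' / D.
  rewrite /b -mulrDl ler_pdivlMr//; move: hy.
  have -> : pi y - pi x = - D by rewrite opprB.
  by rewrite mulrN; lra.
move=> /(ler_wpM2r D'0) kb; rewrite -/D' in hq.
have -> : e = e' + e' / D * D'.
  rewrite -mulrA (mulrC D^-1) -[X in X + _]mulr1 -mulrDr /e' divfK//.
  by rewrite gt_eqF.
by rewrite mulrDl in kb; lra.
Qed.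

Lemma envelope_lip g x x' : potential g ->
  `|envelope g x - envelope g x'| <= (H + L) * `|x - x'|.
Proof.
move=> pg; suff key u v : envelope g u <= envelope g v + (H + L) * `|u - v|.
  rewrite ler_norml; apply/andP; split.
    by have := key x' x; rewrite distrC; lra.
  by have := key x x'; lra.
rewrite -lerBlDr; apply: envelope_ge => // a k [/andP[kH1 kH2] h]; rewrite lerBlDr.
apply: (@envelope_le _ _ _ k); split; first by rewrite kH1.
move=> y; have := h y.
have : C v y - C u y <= L * `|u - v|.
  by rewrite (le_trans (ler_norm _))// (le_trans (CL _ _ _ _))// subrr normr0 addr0 distrC.
have : k * (pi u - pi v) <= H * `|u - v|.
  rewrite (le_trans (ler_norm _))// normrM ler_pM// ?clamp_lip//.
  by rewrite ler_norml kH1.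
by lra.
Qed.

Lemma envelope_clamp g x : envelope g (pi x) = envelope g x.
Proof.
rewrite /envelope; congr inf; apply/seteqP; split => a [k [kH h]]; exists k;
  split => // y;
  have := h y; rewrite (clampK lr).
  by rewrite Cp clampK// -Cp.
by rewrite [in C (pi x) y]Cp clampK// -Cp.
Qed.

Lemma le_envelope g g' e : potential g -> potential g' ->
  (forall x, g x <= g' x + e) -> forall x, envelope g x <= envelope g' x + e.
Proof.
move=> pg pg' gg' x; rewrite -lerBlDr; apply: envelope_ge => // a k [kH h].
rewrite lerBlDr; apply: (@envelope_le _ _ _ k); split => // y.
by have := h y; have := gg' y; lra.
Qed.

Lemma potential_lipf g : potential g -> lipf g.
Proof. by move=> [gL _]; exists (H + L). Qed.

Lemma lipf_envelope g : potential g -> lipf (envelope g).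
Proof. by move=> pg; exists (H + L) => x y; exact: envelope_lip. Qed.

(** For [t >= - H], the sublevel set at [t] is closed: it is cut out by inequalities indexed by [y],
    each of them Lipschitz in [x]. *)
Lemma slope_measurable g : potential g -> measurable_fun setT (slope g).
Proof.
move=> pg; apply: (measurability _ (RGenOInfty.measurableE R)).
move=> _ [_ [t ->] <-]; rewrite setTI.
rewrite (_ : _ @^-1` _ = ~` [set x | - H <= t /\ slope g x <= t]); last first.
  apply/seteqP; split => x; rewrite /= in_itv/= andbT.
    by move=> tx [_]; rewrite leNgt tx.
  move=> h; rewrite ltNge; apply/negP => st; apply: h; split => //.
  by have [/andP[Hs _] _] := slope_tangent x pg; exact: le_trans st.
apply: measurableC; apply: closed_measurable.
have [tH|tH] := pselect (- H <= t); last first.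
  suff -> : [set x | - H <= t /\ slope g x <= t] = set0 by exact: closed0.
  by apply/seteqP; split => // x [/=].
have -> : [set x | - H <= t /\ slope g x <= t] = [set x | forall y,
    g (Num.max (pi x) (pi y)) - C x (Num.max (pi x) (pi y)) - envelope g x
    - t * (Num.max (pi x) (pi y) - pi x) <= 0].
  apply/seteqP; split => x /=.
    move=> [_ st] y; rewrite subr_le0.
    have [z [xz -> -> ->]] := potential_clamp_max x y pg.
    have [_ /(_ z)] := slope_tangent x pg; rewrite -lerBlDl => h.
    by apply: le_trans h _; rewrite ler_wpM2r// subr_ge0.
  move=> h; split => //; apply: ge_inf; first by exists (- H) => k [].
  by split => // y; rewrite -subr_le0.
apply: closed_forall_le0 => y.
have lm : lipf (fun x => Num.max (pi x) (pi y)).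
  exists 1 => u v; rewrite mul1r !(maxC _ (pi y)) (le_trans (max_lip _ _ _))//.
  exact: clamp_lip.
apply: lipfB; last by apply: lipfZ; apply: lipfB => //; exact: lipf_clamp.
apply: lipfB; last exact: lipf_envelope.
have [M mM] := lm.
apply: lipfB.
  exists ((H + L) * M) => u v; have [gL _] := pg.
  by rewrite (le_trans (gL _ _))// -mulrA ler_wpM2l// addr_ge0.
exists (L * (1 + M)) => u v; rewrite (le_trans (CL _ _ _ _))// -mulrA ler_wpM2l//.
by rewrite mulrDl mul1r lerD.
Qed.

End transform.

Section dual_value.
Variables (R : realType) (l r L H : R) (C : R -> R -> R) (mu nu : probability R R).
Hypotheses (lr : l <= r) (L0 : 0 <= L) (H0 : 0 <= H)
  (CL : forall x y x' y', `|C x y - C x' y'| <= L * (`|x - x'| + `|y - y'|))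
  (Cp : forall x y, C x y = C (clamp l r x) (clamp l r y)).
Local Notation pi := (clamp l r).
Local Notation K := (H + L).
Local Notation potential := (potential l r L H).
Local Notation envelope := (envelope l r H C).
Implicit Types (g f h : R -> R) (x y a k e : R).

Lemma lipf_clamp_bm f : lipf f -> (forall x, f (pi x) = f x) -> bm f.
Proof.
move=> lf fp; split; first exact: lipf_measurable.
have [M fM] := lf; exists (`|f l| + `|M| * (r - l)) => x.
rewrite -[f x](subrK (f l)) addrC (le_trans (ler_normD _ _))// lerD2l.
rewrite -(fp x) -(fp l) (le_trans (fM _ _))//.
apply: (@le_trans _ _ (`|M| * `|pi x - pi l|)).
  by rewrite ler_wpM2r// ler_norm.
by rewrite ler_wpM2l// clamp_dist.
Qed.

Lemma potential_bm g : potential g -> bm g.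
Proof. by move=> pg; apply: lipf_clamp_bm; [exact: potential_lipf pg|case: pg]. Qed.

Lemma envelope_bm g : potential g -> bm (envelope g).
Proof.
by move=> pg; apply: lipf_clamp_bm => [|x];
  [exact: (lipf_envelope lr L0 H0 CL Cp pg)|exact: envelope_clamp].
Qed.

Lemma cost_bdd : exists M, forall x y, `|C x y| <= M.
Proof.
exists (`|C l l| + L * ((r - l) + (r - l))) => x y.
rewrite -[C x y](subrK (C l l)) addrC (le_trans (ler_normD _ _))// lerD2l.
rewrite (Cp x y) (Cp l l) (le_trans (CL _ _ _ _))// ler_wpM2l//.
by rewrite lerD// clamp_dist.
Qed.

Definition dual_value g := \int[nu]_y g y - \int[mu]_x envelope g x.

Lemma dual_value_close g g' e : potential g -> potential g' ->
  (forall x, `|g x - g' x| <= e) -> dual_value g' <= dual_value g + e *+ 2.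
Proof.
move=> pg pg' gg'.
have h1 : \int[nu]_y g' y <= \int[nu]_y g y + e.
  rewrite -[X in _ + X](int_cst nu) -bm_intD; [|exact: potential_bm|exact: bm_cst].
  apply: bm_int_le => [||x]; [exact: potential_bm| |].
    by apply: bmD; [exact: potential_bm|exact: bm_cst].
  by move: (gg' x); rewrite distrC ler_norml => /andP[]; lra.
have h2 : \int[mu]_y envelope g y <= \int[mu]_y envelope g' y + e.
  rewrite -[X in _ + X](int_cst mu) -bm_intD; [|exact: envelope_bm|exact: bm_cst].
  apply: bm_int_le => [||x]; [exact: envelope_bm| |].
    by apply: bmD; [exact: envelope_bm|exact: bm_cst].
  apply: (le_envelope lr L0 H0 CL Cp pg pg') => y.
  by move: (gg' y); rewrite ler_norml => /andP[]; lra.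
by rewrite /dual_value; lra.
Qed.

Lemma potential_shift g a : potential g -> potential (fun x => g x + a).
Proof.
move=> [gL gp]; split => x; last by rewrite gp.
by move=> y; rewrite opprD addrACA subrr addr0.
Qed.

Lemma dual_value_shift g a : potential g ->
  dual_value (fun x => g x + a) = dual_value g.
Proof.
move=> pg; have pga := potential_shift a pg; rewrite /dual_value.
have -> : envelope (fun x => g x + a) = (fun x => envelope g x + a).
  apply/funext => x; apply/eqP; rewrite eq_le; apply/andP; split.
    exact: (le_envelope lr L0 H0 CL Cp pga pg).
  rewrite -lerBrDr; apply: (le_envelope lr L0 H0 CL Cp pg pga) => y.
  by rewrite addrK.
rewrite bm_intD; [|exact: potential_bm|exact: bm_cst].
rewrite bm_intD; [|exact: envelope_bm|exact: bm_cst].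
by rewrite !int_cst opprD addrACA subrr addr0.
Qed.

Lemma potential_osc g x y : potential g -> g x <= g y + K * (r - l).
Proof.
move=> [gL gp]; rewrite -lerBlDl -(gp x) -(gp y) (le_trans (ler_norm _))//.
by rewrite (le_trans (gL _ _))// ler_wpM2l ?addr_ge0// clamp_dist.
Qed.

Lemma dual_value_ub : exists M, forall g, potential g -> dual_value g <= M.
Proof.
have [B CB] := cost_bdd; exists (K * (r - l) *+ 2 + B) => g pg.
have h1 : \int[nu]_y g y <= g l + K * (r - l).
  rewrite -[leRHS](int_cst nu); apply: bm_int_le => [||x];
    first exact: potential_bm.
    exact: bm_cst.
  exact: potential_osc.
have h2 : g l - K * (r - l) - B <= \int[mu]_x envelope g x.
  rewrite -[leLHS](int_cst mu); apply: bm_int_le => [||x]; first exact: bm_cst.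
    exact: envelope_bm.
  apply: (envelope_ge lr L0 H0 CL Cp pg) => a k /tangent_ge; apply: le_trans.
  have := potential_osc l x pg; have := CB x x; rewrite ler_norml => /andP[]; lra.
by rewrite /dual_value; lra.
Qed.

(* Tychonoff's theorem gives a cluster point of a maximising sequence;
   equicontinuity upgrades pointwise to uniform closeness. *)
Lemma dual_value_max : exists2 g, potential g &
  forall g', potential g' -> dual_value g' <= dual_value g.
Proof.
pose V := [set dual_value g | g in potential].
have p0 : potential (fun=> 0).
  by split => // x y; rewrite subrr normr0 mulr_ge0// addr_ge0.
have supV : has_sup V.
  split; first by exists (dual_value (fun=> 0)); exists (fun=> 0).
  by have [M hM] := dual_value_ub; exists M => _ [g pg <-]; exact: hM.
(* Adding a constant leaves the dual value unchanged, so the maximising sequence is normalised to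
   vanish at [l]; it then lies in a product of segments [[- B, B]]. *)
have /choice[u Hu] : forall n : nat, exists g, [/\ potential g, g l = 0 &
    sup V - n.+1%:R^-1 < dual_value g].
  move=> n; have [|_ [g pg <-] ?] := @sup_adherent _ V (n.+1%:R^-1) _ supV.
    by rewrite invr_gt0.
  exists (fun x => g x + (- g l)); split; first exact: potential_shift.
    by rewrite subrr.
  by rewrite dual_value_shift.
have pu n : potential (u n) by have [] := Hu n.
pose B := K * (r - l).
pose A (x : R) : set R := `[- B, B]%classic.
have cA : compact [set f : {ptws R -> R} | forall x, A x (f x)].
  by apply: tychonoff => x; exact: segment_compact.
have [|g [_ clg]] := cA (u @ \oo) _.
  exists 0%N => // n _ x /=; rewrite /A /= in_itv/=.
  have [_ u0 _] := Hu n.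
  have := potential_osc x l (pu n); have := potential_osc l x (pu n).
  by rewrite u0 -/B => ? ?; apply/andP; split; lra.
have near_u (s : seq R) e n0 : 0 < e ->
    exists2 n, (n0 <= n)%N & forall x, x \in s -> `|g x - u n x| <= e.
  move=> e0; pose U := [set f : {ptws R -> R} | forall x, x \in s -> `|g x - f x| <= e].
  have nU : nbhs g U.
    rewrite {}/U; elim: s => [|x s IH]; first exact: filterS filterT.
    have h : nbhs g [set f : {ptws R -> R} | `|g x - f x| <= e].
      have hB : nbhs (g x : R) [set y : R | `|g x - y| <= e].
        by apply: filterS (nbhsx_ballx (g x : R) e e0) => y /ltW.
      exact: (@proj_continuous R (fun=> R) x g _ hB).
    apply: filterS (filterI h IH) => f /= [fx fs] y.
    by rewrite inE => /predU1P[->|/fs].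
  have Fn : (u @ \oo) [set f | exists2 n, (n0 <= n)%N & f = u n].
    by exists n0 => // n /= n0n; exists n.
  by have [_ [[n n0n ->] h]] := clg _ _ Fn nU; exists n.
have pg : potential g.
  split => [x y|x].
    apply/ler_addgt0Pr => e e0.
    have e20 : 0 < e / 2 by rewrite divr_gt0.
    have [n _ h] := near_u [:: x; y] _ 0%N e20.
    have := h x; have := h y; rewrite !inE !eqxx orbT => /(_ isT) h1 /(_ isT) h2.
    have [uL _] := pu n; have := uL x y.
    have -> : g x - g y = (g x - u n x) + (u n x - u n y) - (g y - u n y) by lra.
    have := ler_normB (g x - u n x + (u n x - u n y)) (g y - u n y).
    have := ler_normD (g x - u n x) (u n x - u n y).
    by lra.
  apply/eqP; rewrite -subr_eq0 -normr_le0; apply/ler_addgt0Pr => e e0;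
    rewrite add0r.
  have e20 : 0 < e / 2 by rewrite divr_gt0.
  have [n _ h] := near_u [:: x; pi x] _ 0%N e20.
  have := h x; have := h (pi x); rewrite !inE !eqxx orbT => /(_ isT) h1 /(_ isT) h2.
  have [_ up] := pu n.
  have -> : g (pi x) - g x = (g (pi x) - u n (pi x)) - (g x - u n x).
    by rewrite up; lra.
  by have := ler_normB (g (pi x) - u n (pi x)) (g x - u n x); lra.
exists g => // g' pg'.
apply: (@le_trans _ _ (sup V)); first by apply: ub_le_sup; [case: supV|exists g'].
apply/ler_addgt0Pr => e e0.
(* Uniform distance [3 e'] costs [6 e'] in dual value, and the chosen term of the sequence is within
   [e'] of the supremum. *)
pose e' := e / 8.
have e'0 : 0 < e' by rewrite divr_gt0.
pose dl := e' / (K + 1).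
have K0 : 0 <= K by rewrite addr_ge0.
have K1 : 0 < K + 1 by rewrite ltr_wpDl.
have dl0 : 0 < dl by rewrite divr_gt0.
have Kdl : K * dl <= e'.
  rewrite /dl mulrCA; apply: ler_piMr; first exact: ltW.
  by rewrite ler_pdivrMr// mul1r lerDl.
(* A grid of mesh [dl], on which potentials vary by at most [e'] between neighbours; closeness on
   this finite set is what a cluster point provides. *)
pose s := [seq l + i%:R * dl | i <- iota 0 (Num.truncn ((r - l) / dl)).+1].
pose n0 := Num.truncn e'^-1.
have [n n0n h] := near_u s _ n0 e'0.
have unif x : `|g x - u n x| <= e' *+ 3.
  have [_ gp] := pg; have [_ up] := pu n; rewrite -gp -up.
  pose i := Num.truncn ((pi x - l) / dl).
  have /andP[lp pr] := clamp_itv lr x.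
  have q0 : 0 <= (pi x - l) / dl by apply: divr_ge0; [rewrite subr_ge0|exact: ltW].
  have /andP[i1 i2] : i%:R * dl <= pi x - l < i.+1%:R * dl.
    by rewrite -ler_pdivlMr// -ltr_pdivrMr//; exact: truncn_itv.
  have is_ : l + i%:R * dl \in s.
    apply/mapP; exists i => //; rewrite mem_iota /= add0n ltnS.
    by apply: le_truncn; rewrite ler_pM2r ?invr_gt0// lerB.
  have dist : `|pi x - (l + i%:R * dl)| <= dl.
    by rewrite ler_norml; move: i2; rewrite -natr1 mulrDl mul1r => i2; apply/andP;
      split; lra.
  set q := l + i%:R * dl in is_ dist.
  have := h q is_.
  have [gL _] := pg; have [uL _] := pu n.
  have gq : `|g (pi x) - g q| <= e'.
    by rewrite (le_trans (gL _ _))// (le_trans _ Kdl)// ler_wpM2l.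
  have uq : `|u n (pi x) - u n q| <= e'.
    by rewrite (le_trans (uL _ _))// (le_trans _ Kdl)// ler_wpM2l.
  have -> : g (pi x) - u n (pi x) =
    (g (pi x) - g q) + (g q - u n q) - (u n (pi x) - u n q) by lra.
  have := ler_normB (g (pi x) - g q + (g q - u n q)) (u n (pi x) - u n q).
  have := ler_normD (g (pi x) - g q) (g q - u n q).
  by lra.
have := dual_value_close pg (pu n) unif.
have [_ _] := Hu n.
have : n.+1%:R^-1 <= e'.
  rewrite invf_ple ?posrE//; apply: ltW; apply: lt_le_trans (truncnS_gt _) _.
  by rewrite ler_nat ltnS.
by rewrite /e'; move: (n.+1%:R^-1) => t; lra.
Qed.

(** Restricting to potentials loses nothing. The infimum over [x] of
    [f x + h x * (pi y - pi x) + C x y] is a potential above [g], and the value [f x] with slope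
    [h x] is a tangent for it, so its envelope lies below [f]. *)
Lemma admissible_le_dual f g h : bm f -> bm g -> (forall x, `|h x| <= H) ->
  (forall x y, g y - f x - h x * (pi y - pi x) <= C x y) ->
  exists2 g', potential g' & \int[nu]_y g y - \int[mu]_x f x <= dual_value g'.
Proof.
move=> bf bg hH adm.
pose S y := [set f x + h x * (pi y - pi x) + C x y | x in setT].
have lbS y : lbound (S y) (g y).
  by move=> _ [x _ <-]; have := adm x y; lra.
have S0 y : S y !=set0 by exists (f l + h l * (pi y - pi l) + C l y); exists l.
pose g' y := inf (S y).
have g'le x y : g' y <= f x + h x * (pi y - pi x) + C x y.
  by apply: ge_inf; [exists (g y)|exists x].
have key y z : g' y <= g' z + K * `|y - z|.
  rewrite -lerBlDr; apply: lb_le_inf => // _ [x _ <-]; rewrite lerBlDr.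
  apply: le_trans (g'le x y) _.
  have : C x y - C x z <= L * `|y - z|.
    by rewrite (le_trans (ler_norm _))// (le_trans (CL _ _ _ _))// subrr normr0 add0r.
  have : h x * (pi y - pi z) <= H * `|y - z|.
    by rewrite (le_trans (ler_norm _))// normrM ler_pM// clamp_lip.
  by lra.
have pg' : potential g'.
  split => [x y|y].
    rewrite ler_norml; apply/andP; split.
      by have := key y x; rewrite distrC; lra.
    by have := key x y; lra.
  congr inf; apply/seteqP; split => a [x _ <-]; exists x => //.
    by rewrite clampK// (Cp x y) (Cp x (pi y)) clampK.
  by rewrite clampK// (Cp x y) (Cp x (pi y)) clampK.
exists g' => //; apply: lerB.
  apply: bm_int_le => // [|y]; first exact: potential_bm.
  exact: lb_le_inf.
apply: bm_int_le => // [|x]; first exact: envelope_bm.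
suff h' : tangent l r H C g' x (f x) (h x) by exact: envelope_le h'.
split; first by rewrite -ler_norml.
by move=> y; have := g'le x y; lra.
Qed.

End dual_value.

(** * Measurability of functions on the plane *)

Section plane.
Variable R : realType.

Lemma open_measurable2 (U : set (R * R)) : open U -> measurable U.
Proof.
move=> oU.
pose box (q : (rat * rat) * (rat * rat)) : set (R * R) :=
  `]ratr q.1.1, ratr q.1.2[%classic `*` `]ratr q.2.1, ratr q.2.2[%classic.
have -> : U = \bigcup_q (if `[< box q `<=` U >] then box q else set0).
  apply/seteqP; split => [[x y] Uxy|z [q _]]; last first.
    by case: ifP => // /asboolP; exact.
  move: oU; rewrite openE => /(_ _ Uxy) [[A B] /= [/nbhs_ballP[e1 e10 A1] /nbhs_ballP[e2 e20 B2]] ABU].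
  have ritv (p q : R) : p < q -> exists a : rat, p < ratr a < q.
    by move=> /rat_in_itvoo[a]; rewrite in_itv/= => ?; exists a.
  have [|a /andP[a1 a2]] := ritv (x - e1) x; first by rewrite ltrBlDr ltrDl.
  have [|b /andP[b1 b2]] := ritv x (x + e1); first by rewrite ltrDl.
  have [|c /andP[c1 c2]] := ritv (y - e2) y; first by rewrite ltrBlDr ltrDl.
  have [|d /andP[d1 d2]] := ritv y (y + e2); first by rewrite ltrDl.
  exists ((a, b), (c, d)) => //; rewrite ifT.
    by split; rewrite /= in_itv /=; apply/andP.
  apply/asboolP.
    move=> [s t] /= []; rewrite /= !in_itv /=.
    move: (ratr a) (ratr b) (ratr c) (ratr d) a1 a2 b1 b2 c1 c2 d1 d2.
    move=> a' b' c' d' ? ? ? ? ? ? ? ? /andP[? ?] /andP[? ?].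
    apply: ABU; split; [apply: A1|apply: B2]; rewrite /ball /= ltr_norml;
    by apply/andP; split; lra.
apply: countable_bigcupT_measurable => [|q]; first exact: countableP.
case: ifP => // _; by apply: measurableX; exact: measurable_itv.
Qed.

Lemma lsc_measurable2 (f : R * R -> \bar R) :
  lower_semicontinuous f -> measurable_fun setT f.
Proof.
move=> scif; apply: (measurability _ (ErealGenOInfty.measurableE R)).
move=> /= _ [_ [a ->]] <-; apply: measurableI => //; apply: open_measurable2.
by rewrite preimage_itvoy; move/lower_semicontinuousP : scif; exact.
Qed.

Lemma lip_measurable2 (f : R * R -> R) M :
  (forall z z', `|f z - f z'| <= M * (`|z.1 - z'.1| + `|z.2 - z'.2|)) ->
  measurable_fun setT f.
Proof.
move=> fM; apply/measurable_EFinP; apply: lsc_measurable2.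
apply/lower_semicontinuousP => a.
rewrite openE => -[x y] /=; rewrite lte_fin => afz.
pose e := (f (x, y) - a) / (`|M| + 1) / 2.
have M1 : 0 < `|M| + 1 by rewrite ltr_wpDl.
have e0 : 0 < e by rewrite !divr_gt0 ?subr_gt0.
exists (ball x e, ball y e); first by split; exact: nbhsx_ballx.
move=> [s t] [/=]; rewrite /ball /= lte_fin => xs yt.
have := fM (x, y) (s, t); rewrite /= => h.
have : f (x, y) - f (s, t) < f (x, y) - a.
  apply: le_lt_trans (ler_norm _) _; apply: le_lt_trans h _.
  apply: (@le_lt_trans _ _ ((`|M| + 1) * (`|x - s| + `|y - t|))).
    by rewrite ler_wpM2r ?addr_ge0// (le_trans (ler_norm _))// lerDl.
  have -> : f (x, y) - a = (`|M| + 1) * (e + e).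
    by rewrite /e -splitr mulrC divfK// gt_eqF.
  by rewrite ltr_pM2l// ltrD.
by lra.
Qed.

End plane.

(** * Complementary slackness in the relaxed problem *)

Section couplings.
Variables (R : realType).
Implicit Types (mu nu : probability R R) (P : probability (R * R)%type R).

Definition coupling mu nu P :=
  (forall A, measurable A -> P (fst @^-1` A) = mu A) /\
  (forall B, measurable B -> P (snd @^-1` B) = nu B).

Lemma bm_fst (f : R -> R) : bm f -> bm (fun z : R * R => f z.1).
Proof.
move=> [mf [M fM]]; split; last by exists M.
exact: (measurableT_comp mf measurable_fst).
Qed.

Lemma bm_snd (f : R -> R) : bm f -> bm (fun z : R * R => f z.2).
Proof.
move=> [mf [M fM]]; split; last by exists M.
exact: (measurableT_comp mf measurable_snd).
Qed.

Lemma integral_map d (T : measurableType d) (P : probability T R)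
    (m : probability R R) (phi : T -> R) f : measurable_fun setT phi ->
  (forall A, measurable A -> P (phi @^-1` A) = m A) -> bm f ->
  bm (f \o phi) ->
  \int[P]_z f (phi z) = \int[m]_x f x.
Proof.
move=> mphi Pm bf bfp; rewrite /Rintegral; congr fine.
rewrite -[LHS](@integral_pushforward _ _ _ _ _ _ mphi P setT (EFin \o f)) //.
- by apply: eq_measure_integral => A mA _; exact: Pm.
- by apply/measurable_EFinP; case: bf.
- by rewrite preimage_setT; exact: bm_integrable.
Qed.

Lemma int_fst mu nu P f : coupling mu nu P -> bm f ->
  \int[P]_z f z.1 = \int[mu]_x f x.
Proof.
by move=> [P1 _] bf; apply: integral_map => //; exact: (bm_fst bf).
Qed.

Lemma int_snd mu nu P f : coupling mu nu P -> bm f ->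
  \int[P]_z f z.2 = \int[nu]_x f x.
Proof.
by move=> [_ P2] bf; apply: integral_map => //; exact: (bm_snd bf).
Qed.

End couplings.

Section agreement.
Variables (R : realType) (P : probability (R * R)%type R)
  (Lam : (R * R -> R) -> R).
Hypotheses
  (LamD : forall v w, bdd v -> bdd w -> Lam (fun z => v z + w z) = Lam v + Lam w)
  (LamZ : forall a v, bdd v -> Lam (fun z => a * v z) = a * Lam v)
  (Lam_ge0 : forall v, bdd v -> (forall z, 0 <= v z) -> 0 <= Lam v)
  (Lam1 : Lam (fun=> 1) = 1)
  (LamP : forall A B, measurable A -> measurable B ->
     P (A `*` B) = (Lam \1_(A `*` B))%:E).
Implicit Types v w : R * R -> R.

(** [Lam] is not known to be continuous along monotone sequences, so agreement with [P] is extended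
    from rectangles by linearity and uniform limits only. *)
Let agree v := bm v /\ Lam v = \int[P]_z v z.

Lemma le_Lam v w : bdd v -> bdd w -> (forall z, v z <= w z) -> Lam v <= Lam w.
Proof.
move=> bv bw vw; rewrite -subr_ge0.
have -> : Lam w - Lam v = Lam (fun z => w z + (-1) * v z).
  by rewrite LamD ?LamZ ?mulN1r//; exact: bddZ.
apply: Lam_ge0 => [|z]; first by apply: bddD => //; exact: bddZ.
by rewrite mulN1r subr_ge0.
Qed.

Lemma agreeD v w : agree v -> agree w -> agree (fun z => v z + w z).
Proof.
move=> [bv lv] [bw lw]; split; first exact: bmD.
by rewrite LamD ?lv ?lw ?bm_intD//; [case: bv|case: bw].
Qed.

Lemma agreeZ a v : agree v -> agree (fun z => a * v z).
Proof.
move=> [bv lv]; split; first exact: bmZ.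
by rewrite LamZ ?lv ?bm_intZ//; case: bv.
Qed.

Lemma agree_sum n (F : nat -> R * R -> R) : (forall i, agree (F i)) ->
  agree (fun z => \sum_(i < n) F i z).
Proof.
move=> aF; elim: n => [|n IH].
  under eq_fun do rewrite big_ord0; split; first exact: bm_cst.
  rewrite int_cst.
  have -> : (fun=> 0) = (fun z : R * R => 0 * (fun=> 1) z :> R).
    by apply/funext => z; rewrite mul0r.
  by rewrite LamZ ?mul0r//; exact: bdd_cst.
by under eq_fun do rewrite big_ord_recr/=; exact: agreeD.
Qed.

Lemma agree_uniform v : bm v ->
  (forall e, 0 < e -> exists2 w, agree w & forall z, `|v z - w z| <= e) ->
  agree v.
Proof.
move=> bv h; split => //; apply/eqP; rewrite -subr_eq0 -normr_le0.
apply/ler_addgt0Pr => e e0; rewrite add0r.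
have e20 : 0 < e / 2 by rewrite divr_gt0.
have [w [bw lw] vw] := h _ e20.
have bd : bdd v by case: bv.
have bdw : bdd w by case: bw.
have be : bm (fun _ : R * R => e / 2) by exact: bm_cst.
have bde : bdd (fun _ : R * R => e / 2) by exact: bdd_cst.
have Le : Lam (fun=> e / 2) = e / 2.
  by rewrite -[X in (fun=> X)]mulr1 LamZ ?Lam1 ?mulr1//; exact: bdd_cst.
have h1 : Lam v <= Lam w + e / 2.
  rewrite -Le -LamD//; apply: le_Lam => // [|z]; first exact: bddD.
  by move: (vw z); rewrite ler_norml => /andP[]; lra.
have h2 : Lam w <= Lam v + e / 2.
  rewrite -[X in _ <= _ + X]Le -LamD//; apply: le_Lam => // [|z]; first exact: bddD.
  by move: (vw z); rewrite ler_norml => /andP[]; lra.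
have h3 : \int[P]_z v z <= \int[P]_z w z + e / 2.
  rewrite -[X in _ <= _ + X](int_cst P) -bm_intD//; apply: bm_int_le => // [|z];
    first exact: bmD.
  by move: (vw z); rewrite ler_norml => /andP[]; lra.
have h4 : \int[P]_z w z <= \int[P]_z v z + e / 2.
  rewrite -[X in _ <= _ + X](int_cst P) -bm_intD//; apply: bm_int_le => // [|z];
    first exact: bmD.
  by move: (vw z); rewrite ler_norml => /andP[]; lra.
by rewrite ler_norml; apply/andP; split; lra.
Qed.

Lemma indicX (A B : set R) z : \1_(A `*` B) z = \1_A z.1 * \1_B z.2 :> R.
Proof.
case: z => x y; rewrite !indicE /= in_setX /=.
by case: (_ \in A); case: (_ \in B); rewrite ?mulr1 ?mulr0.
Qed.

Lemma agree_indic A B : measurable A -> measurable B ->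
  agree (fun z => \1_A z.1 * \1_B z.2).
Proof.
move=> mA mB.
have -> : (fun z : R * R => \1_A z.1 * \1_B z.2 : R) = \1_(A `*` B).
  by apply/funext => z; rewrite indicX.
have mAB : measurable (A `*` B) by exact: measurableX.
by split; [exact: bm_indic|rewrite int_indic// LamP].
Qed.

Lemma agree_bm_indic f B : bm f -> measurable B ->
  agree (fun z => f z.1 * \1_B z.2).
Proof.
move=> bf mB; apply: agree_uniform.
  apply: (@bmM _ _ _ (fun z => f z.1) (fun z => \1_B z.2)); first exact: bm_fst.
  exact: (@bm_snd R \1_B (bm_indic R mB)).
move=> e e0; have [n [a [A [mA fA]]]] := bm_approx bf e0.
exists (fun z => \sum_(i < n) a i * (\1_(A i) z.1 * \1_B z.2)).
  by apply: (@agree_sum n (fun i z => a i * (\1_(A i) z.1 * \1_B z.2))) => i;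
    apply: agreeZ; exact: agree_indic.
move=> z; have -> : \sum_(i < n) a i * (\1_(A i) z.1 * \1_B z.2) =
    (\sum_(i < n) a i * \1_(A i) z.1) * \1_B z.2.
  by rewrite mulr_suml; apply: eq_bigr => i _; rewrite mulrA.
rewrite -mulrBl normrM (le_trans _ (fA z.1))// ler_piMr//.
by rewrite indicE; case: (_ \in _); rewrite ?normr1 ?normr0.
Qed.

Lemma agree_lip l r M (xi : R -> R -> R) : l <= r ->
  bm (fun z => xi z.1 z.2) -> (forall y, bm (xi ^~ y)) ->
  (forall x y, xi x (clamp l r y) = xi x y) ->
  (forall x y y', `|xi x y - xi x y'| <= M * `|y - y'|) ->
  agree (fun z => xi z.1 z.2).
Proof.
move=> lr bxi bx xip xiM; apply: agree_uniform => // e e0.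
pose dl := e / (`|M| + 1).
have M1 : 0 < `|M| + 1 by rewrite ltr_wpDl.
have dl0 : 0 < dl by rewrite divr_gt0.
have Mdl : M * dl <= e.
  apply: (@le_trans _ _ ((`|M| + 1) * dl)).
    by rewrite ler_wpM2r ?ltW// ltr_pwDr// ler_norm.
  by rewrite /dl mulrC divfK// gt_eqF.
pose ix y := Num.truncn ((clamp l r y - l) / dl).
have ixP y : (ix y)%:R * dl <= clamp l r y - l < (ix y).+1%:R * dl.
  have /andP[lp _] := clamp_itv lr y.
  rewrite -ler_pdivlMr// -ltr_pdivrMr//; apply: truncn_itv.
  by apply: divr_ge0; [rewrite subr_ge0|exact: ltW].
pose n := (Num.truncn ((r - l) / dl)).+1.
have ixn y : (ix y < n)%N.
  rewrite ltnS; apply: le_truncn; rewrite ler_pM2r ?invr_gt0// lerB//.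
  by have /andP[_] := clamp_itv lr y.
pose B i := [set y | ix y = i].
have mB i : measurable (B i).
  have mc : measurable_fun setT (fun y => clamp l r y - l).
    by apply: lipf_measurable; apply: lipfB; [exact: lipf_clamp|exact: lipf_cst].
  rewrite (_ : B i = (fun y => clamp l r y - l) @^-1` `[i%:R * dl, i.+1%:R * dl[%classic).
    by rewrite -[X in measurable X]setTI; apply: mc => //; exact: measurable_itv.
  apply/seteqP; split => y; rewrite /B /= in_itv/=.
    by move=> <-; exact: ixP.
  move=> h; have := ixP y; move: h => /andP[h1 h2] /andP[h3 h4].
  apply/eqP; rewrite eqn_leq; apply/andP; split;
    rewrite -ltnS -(ltr_nat R) -(ltr_pM2r dl0).
    exact: le_lt_trans h3 h2.
  exact: le_lt_trans h1 h4.
exists (fun z => \sum_(i < n) xi z.1 (l + i%:R * dl) * \1_(B i) z.2).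
  apply: (@agree_sum n (fun i z => xi z.1 (l + i%:R * dl) * \1_(B i) z.2)) => i.
  exact: (@agree_bm_indic (xi ^~ (l + i%:R * dl)) (B i) (bx _) (mB i)).
move=> [x y] /=.
rewrite (bigD1 (Ordinal (ixn y)))//= big1 ?addr0; last first.
  move=> i; rewrite indicE => /eqP iy; rewrite memNset ?mulr0// /B /= => E.
  by apply: iy; apply: val_inj => /=.
rewrite indicE mem_set// mulr1 -xip (le_trans (xiM _ _ _))// (le_trans _ Mdl)//.
have : `|clamp l r y - (l + (ix y)%:R * dl)| <= dl.
  have := ixP y; rewrite -natr1 mulrDl mul1r => /andP[? ?].
  by rewrite ler_norml; apply/andP; split; lra.
have [M0|M0] := leP 0 M; first by move=> ?; rewrite ler_wpM2l.
have := xiM x l (l + 1).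
have -> : l - (l + 1) = -1 by lra.
rewrite normrN1 mulr1 => h.
by have := le_lt_trans (le_trans (normr_ge0 _) h) M0; rewrite ltxx.
Qed.

End agreement.

Section relaxed_problem.
Variables (R : realType) (l r L H D : R) (C : R -> R -> R) (mu nu : probability R R)
  (f g h : R -> R).
Hypotheses (lr : l <= r) (L0 : 0 <= L) (H0 : 0 <= H)
  (CL : forall x y x' y', `|C x y - C x' y'| <= L * (`|x - x'| + `|y - y'|))
  (Cp : forall x y, C x y = C (clamp l r x) (clamp l r y)).
Local Notation pi := (clamp l r).
Hypotheses (bf : bm f) (bg : bm g) (bh : bm h) (hH : forall x, `|h x| <= H)
  (fgh : forall x y, g y - f x - h x * (pi y - pi x) <= C x y)
  (DE : D = \int[nu]_y g y - \int[mu]_x f x)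
  (Dmax : forall f' g' h', bm f' -> bm g' -> (forall x, `|h' x| <= H) ->
    (forall x y, g' y - f' x - h' x * (pi y - pi x) <= C x y) ->
    \int[nu]_y g' y - \int[mu]_x f' x <= D).
Implicit Types xi v w : R * R -> R.

(* [t] homogenises the constraint [g' - f' - h' (y - x) <= C], which makes the
   price below sublinear; only [t = 1] is the relaxed dual problem itself. *)
Let superhedge xi a := exists f' g' h' t, [/\ 0 <= t, bm f', bm g',
  (forall x, `|h' x| <= t * H) &
  (forall x y, xi (x, y) <= f' x - g' y + h' x * (pi y - pi x) + t * C x y) /\
  a = \int[mu]_x f' x - \int[nu]_y g' y + t * D].

Let price xi := inf [set a | superhedge xi a].

(** Here the optimality of [D] enters, and with it [price] is bounded below. For [t = 0], hedging 0
    means [g' <= f'] everywhere; for [t > 0], division by [t] gives a feasible triple of the relaxed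
    dual. *)
Lemma superhedge0_ge0 a : superhedge (fun=> 0) a -> 0 <= a.
Proof.
move=> [f' [g' [h' [t [t0 bf' bg' h'H [sh ->]]]]]].
move: t0; rewrite le_eqVlt => /predU1P[te|t0].
  rewrite -te mul0r addr0 subr_ge0.
  have gf x y : g' y <= f' x.
    have := sh x y; have := h'H x; rewrite -te !mul0r normr_le0 => /eqP ->.
    by rewrite mul0r; lra.
  rewrite -[leLHS](int_cst mu); apply: bm_int_le => // [|x]; first exact: bm_cst.
  rewrite -[leRHS](int_cst nu); by apply: bm_int_le => //; exact: bm_cst.
have ti : t * t^-1 = 1 by rewrite divff// gt_eqF.
have bf2 : bm (fun x => t^-1 * f' x) by exact: bmZ.
have bg2 : bm (fun x => t^-1 * g' x) by exact: bmZ.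
have h2H x : `|t^-1 * h' x| <= H.
  by rewrite normrM gtr0_norm ?invr_gt0// ler_pdivrMl//.
have adm x y : t^-1 * g' y - t^-1 * f' x - t^-1 * h' x * (pi y - pi x) <= C x y.
  rewrite -mulrA -!mulrBr ler_pdivrMl//.
  by have := sh x y; lra.
have := Dmax bf2 bg2 h2H adm; rewrite !bm_intZ// -mulrBr ler_pdivrMl//.
lra.
Qed.

Lemma superhedgeD v w a b : superhedge v a -> superhedge w b ->
  superhedge (fun z => v z + w z) (a + b).
Proof.
move=> [f1 [g1 [h1 [t1 [t10 bf1 bg1 h1H [sh1 ->]]]]]].
move=> [f2 [g2 [h2 [t2 [t20 bf2 bg2 h2H [sh2 ->]]]]]].
exists (fun x => f1 x + f2 x), (fun x => g1 x + g2 x), (fun x => h1 x + h2 x), (t1 + t2).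
split; [exact: addr_ge0|exact: bmD|exact: bmD| |split].
- by move=> x; rewrite mulrDl (le_trans (ler_normD _ _))// lerD.
- by move=> x y; have := sh1 x y; have := sh2 x y; rewrite !mulrDl; lra.
- by rewrite !bm_intD// mulrDl; lra.
Qed.

Lemma superhedgeZ c v a : 0 < c -> superhedge v a ->
  superhedge (fun z => c * v z) (c * a).
Proof.
move=> c0 [f1 [g1 [h1 [t1 [t10 bf1 bg1 h1H [sh1 ->]]]]]].
exists (fun x => c * f1 x), (fun x => c * g1 x), (fun x => c * h1 x), (c * t1).
split; [by rewrite mulr_ge0// ltW|exact: bmZ|exact: bmZ| |split].
- by move=> x; rewrite normrM gtr0_norm// -mulrA ler_wpM2l// ltW.
- by move=> x y; have := ler_wpM2l (ltW c0) (sh1 x y); lra.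
- by rewrite !bm_intZ//; lra.
Qed.

Lemma superhedge_ex v : bdd v -> exists a, superhedge v a.
Proof.
move=> [M vM]; exists (\int[mu]_x M - \int[nu]_y 0 + 0 * D).
exists (fun=> M), (fun=> 0), (fun=> 0), 0; split => //;
  [exact: bm_cst|exact: bm_cst| |].
  by move=> x; rewrite normr0 mul0r.
split => // x y; rewrite !mul0r subr0 !addr0.
exact: le_trans (ler_norm _) (vM _).
Qed.

Lemma price_lb v : bdd v -> exists m, lbound [set a | superhedge v a] m.
Proof.
move=> bv; have [b sb] := superhedge_ex (bddN bv); exists (- b) => a sa.
rewrite -subr_ge0 opprK; apply: superhedge0_ge0.
have := superhedgeD sa sb; congr (superhedge _ _).
by apply/funext => z; rewrite subrr.
Qed.

Lemma price_le v a : bdd v -> superhedge v a -> price v <= a.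
Proof. by move=> bv sa; apply: ge_inf => //; exact: price_lb. Qed.

Lemma price_ge v m : bdd v -> (forall a, superhedge v a -> m <= a) -> m <= price v.
Proof. by move=> bv h'; apply: lb_le_inf => //; exact: superhedge_ex. Qed.

Lemma price_sublinear : sublinear price.
Proof.
split.
- apply/eqP; rewrite eq_le; apply/andP; split.
    apply: price_le; first exact: bdd_cst.
    exists (fun=> 0), (fun=> 0), (fun=> 0), 0; split => //;
      [exact: bm_cst|exact: bm_cst| |].
      by move=> x; rewrite normr0 mul0r.
    split => [x y|]; first by rewrite !mul0r subr0 !addr0.
    by rewrite !int_cst subrr mul0r addr0.
  apply: price_ge; first exact: bdd_cst.
  exact: superhedge0_ge0.
- move=> v w bv bw; rewrite -lerBlDr; apply: price_ge => // a sa.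
  rewrite lerBlDr -lerBlDl; apply: price_ge => // b sb; rewrite lerBlDl.
  by apply: price_le; [exact: bddD|exact: superhedgeD].
- move=> c v c0 bv; rewrite -ler_pdivrMl//; apply: price_ge => // a sa.
  by rewrite ler_pdivrMl//; apply: price_le; [exact: bddZ|exact: superhedgeZ].
Qed.

Lemma lip2_bm (v : R -> R -> R) M :
  (forall x y x' y', `|v x y - v x' y'| <= M * (`|x - x'| + `|y - y'|)) ->
  (exists B, forall x y, `|v x y| <= B) -> bm (fun z : R * R => v z.1 z.2).
Proof.
move=> vM [B vB]; split; last by exists B => z.
by apply: (@lip_measurable2 _ _ M) => z z'; exact: vM.
Qed.

Lemma pi_bm : bm pi.
Proof.
by apply: (@lipf_clamp_bm R l r); [exact: lr|exact: lipf_clamp|exact: clampK].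
Qed.

Lemma drift_bm : bm (fun z : R * R => pi z.2 - pi z.1).
Proof.
apply: (@bmB _ _ _ (fun z => pi z.2) (fun z => pi z.1)).
  exact: bm_snd pi_bm.
exact: bm_fst pi_bm.
Qed.

Lemma slope_drift_bm (k : R -> R) : bm k ->
  bm (fun z : R * R => k z.1 * (pi z.2 - pi z.1)).
Proof.
move=> bk; apply: (@bmM _ _ _ (fun z => k z.1)); first exact: bm_fst.
exact: drift_bm.
Qed.

Lemma cost_bm : bm (fun z : R * R => C z.1 z.2).
Proof. by apply: lip2_bm CL _; exact: (cost_bdd lr L0 CL Cp). Qed.

(** A linear functional below [price] has its values bounded by every explicit superhedge. Hedges in
    [f'] or [g'] alone give the marginals, the zero hedge gives positivity, and two hedges with
    [t = 1] give the two inequalities; agreement then carries these from [Lam] to [P]. *)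
Lemma relaxed_optimizer : exists P : probability (R * R)%type R,
  [/\ coupling mu nu P,
      forall k, bm k -> (forall x, `|k x| <= H) ->
        \int[P]_z ((k z.1 - h z.1) * (pi z.2 - pi z.1)) <= 0 &
      \int[P]_z (C z.1 z.2 + h z.1 * (pi z.2 - pi z.1)) <= D].
Proof.
have [Lam [LamD LamZ Lamp]] := sublinear_minorant price_sublinear.
have Lam_le v a : bdd v -> superhedge v a -> Lam v <= a.
  by move=> bv sa; rewrite (le_trans (Lamp _ bv))// price_le.
have nH x : `|0 : R| <= 0 * H by rewrite normr0 mul0r.
have LamN v : bdd v -> Lam (fun z => - v z) = - Lam v.
  move=> bv; rewrite -[RHS]mulN1r -LamZ//; congr Lam.
  by apply/funext => z; rewrite mulN1r.
have Lam_fst_le k : bm k -> Lam (fun z => k z.1) <= \int[mu]_x k x.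
  move=> bk; apply: Lam_le; first by case: (bm_fst bk).
  exists k, (fun=> 0), (fun=> 0), 0; split => //; [exact: bm_cst|exact: nH|].
  split => [x y|]; first by rewrite !mul0r subr0 !addr0.
  by rewrite int_cst subr0 mul0r addr0.
have Lam_snd_le k : bm k -> Lam (fun z => k z.2) <= \int[nu]_x k x.
  move=> bk; apply: Lam_le; first by case: (bm_snd bk).
  exists (fun=> 0), (fun x => - k x), (fun=> 0), 0; split => //;
    [exact: bm_cst|exact: bmN|exact: nH|].
  split => [x y|]; first by rewrite !mul0r opprK add0r !addr0.
  have -> : (fun x => - k x) = (fun x => -1 * k x).
    by apply/funext => z; rewrite mulN1r.
  by rewrite bm_intZ// int_cst mulN1r opprK mul0r addr0 add0r.
have intN (m : probability R R) k : bm k -> \int[m]_x (- k x) = - \int[m]_x k x.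
  move=> bk; rewrite -[RHS]mulN1r -bm_intZ//; congr (Rintegral _ _ _).
  by apply/funext => z; rewrite mulN1r.
have Lam_fst k : bm k -> Lam (fun z => k z.1) = \int[mu]_x k x.
  move=> bk; apply/eqP; rewrite eq_le Lam_fst_le//=.
  have := Lam_fst_le _ (bmN bk); rewrite intN// -lerN2 opprK => /le_trans; apply.
  by rewrite (LamN (fun z => k z.1)) ?opprK//; case: (bm_fst bk).
have Lam_snd k : bm k -> Lam (fun z => k z.2) = \int[nu]_x k x.
  move=> bk; apply/eqP; rewrite eq_le Lam_snd_le//=.
  have := Lam_snd_le _ (bmN bk); rewrite intN// -lerN2 opprK => /le_trans; apply.
  by rewrite (LamN (fun z => k z.2)) ?opprK//; case: (bm_snd bk).
have Lam_ge0 v : bdd v -> (forall z, 0 <= v z) -> 0 <= Lam v.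
  move=> bv v0; rewrite -oppr_le0 -LamN//; apply: Lam_le; first exact: bddN.
  exists (fun=> 0), (fun=> 0), (fun=> 0), 0; split => //;
    [exact: bm_cst|exact: bm_cst|exact: nH|].
  split => [x y|]; first by rewrite !mul0r subr0 !addr0 oppr_le0.
  by rewrite !int_cst subrr mul0r addr0.
have Lam1 : Lam (fun=> 1) = 1 by rewrite (Lam_fst (fun=> 1)) ?int_cst//;
  exact: bm_cst.
have bdd_indic (A : set (R * R)) : bdd (\1_A : R * R -> R).
  by exists 1 => x; rewrite indicE; case: (_ \in _); rewrite ?normr0 ?normr1.
pose lam (A : set (R * R)) := Lam \1_A.
have lam0 A : 0 <= lam A by apply: Lam_ge0 => // z; rewrite indicE.
have lamU A B : A `&` B = set0 -> lam (A `|` B) = lam A + lam B.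
  move=> AB; rewrite /lam -LamD//; congr Lam; apply/funext => z.
  rewrite !indicE in_setU.
  have [zA|zA] := boolP (z \in A); have [zB|zB] := boolP (z \in B);
    rewrite ?addr0 ?add0r//.
  suff : (A `&` B) z by rewrite AB.
  by split; apply: set_mem.
have lam1 A : measurable A -> (lam (A `*` setT))%:E = mu A.
  move=> mA; rewrite /lam.
  have -> : \1_(A `*` setT) = (fun z : R * R => \1_A z.1) :> (_ -> R).
    by apply/funext => z; rewrite indicX indicT mulr1.
  by rewrite (Lam_fst \1_A) ?int_indic ?fineK// ?fin_num_measure//; exact: bm_indic.
have lam2 B : measurable B -> (lam (setT `*` B))%:E = nu B.
  move=> mB; rewrite /lam.
  have -> : \1_(setT `*` B) = (fun z : R * R => \1_B z.2) :> (_ -> R).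
    by apply/funext => z; rewrite indicX indicT mul1r.
  by rewrite (Lam_snd \1_B) ?int_indic ?fineK// ?fin_num_measure//; exact: bm_indic.
have [P HP] := exists_coupling lam0 lamU lam1 lam2.
have agree := agree_lip LamD LamZ Lam_ge0 Lam1 HP lr.
have Ck : forall k, bm k -> forall y, bm (fun x => k x * (pi y - pi x)).
  move=> k bk y; apply: bmM => //; apply: (@bmB _ _ _ (fun=> pi y));
    first exact: bm_cst.
  exact: pi_bm.
exists P; split.
- split => A mA.
    have -> : fst @^-1` A = A `*` [set: R] by apply/seteqP; split => -[x y] //= [].
    by rewrite HP// lam1.
  have -> : snd @^-1` A = [set: R] `*` A by apply/seteqP; split => -[x y] //= [].
  by rewrite HP// lam2.
- move=> k bk kH.
  have bkh : bm (fun x => k x - h x) by exact: bmB.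
  have [] := agree (H + H) (fun x y => (k x - h x) * (pi y - pi x)).
  + exact: (slope_drift_bm bkh).
  + by move=> y; exact: Ck bkh y.
  + by move=> x y; rewrite clampK.
  + move=> x y y'; rewrite -mulrBr normrM; apply: ler_pM => //.
      by rewrite (le_trans (ler_normB _ _))// lerD.
    have -> : pi y - pi x - (pi y' - pi x) = pi y - pi y' by lra.
    exact: clamp_lip.
  move=> [_ bd] <-; apply: Lam_le => //.
  (* Feasibility of the optimal triple says that [f], [g] with multiplier [k] and one unit of cost
     hedge [(k - h) (y - x)]; the price is [\int f - \int g + D = 0]. *)
  exists f, g, k, 1; split => //; first by move=> x; rewrite mul1r.
  split => [x y /=|]; first by have := fgh x y; rewrite mul1r mulrBl; lra.
  by rewrite DE; lra.
- have bCh : bm (fun z : R * R => C z.1 z.2 + h z.1 * (pi z.2 - pi z.1)).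
    by apply: (@bmD _ _ _ (fun z => C z.1 z.2));
      [exact: cost_bm|exact: slope_drift_bm].
  have [] := agree (L + H) (fun x y => C x y + h x * (pi y - pi x)) bCh.
  + move=> y; apply: (@bmD _ _ _ (C ^~ y)); last exact: Ck.
    have [B CB] := cost_bdd lr L0 CL Cp.
    split; last by exists B.
    apply: lipf_measurable; exists L => x x'.
    by rewrite (le_trans (CL _ _ _ _))// subrr normr0 addr0.
  + by move=> x y; rewrite clampK// (Cp x y) (Cp x (pi y)) clampK.
  + move=> x y y'.
    have -> : C x y + h x * (pi y - pi x) - (C x y' + h x * (pi y' - pi x)) =
      (C x y - C x y') + h x * (pi y - pi y') by lra.
    rewrite mulrDl (le_trans (ler_normD _ _))// lerD//.
      by rewrite (le_trans (CL _ _ _ _))// subrr normr0 add0r.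
    by rewrite normrM ler_pM// clamp_lip.
  move=> [_ bd] <-; apply: Lam_le => //.
  (* The multiplier [h] and one unit of cost replicate the integrand exactly, at price [D]. *)
  exists (fun=> 0), (fun=> 0), h, 1; split => //; [exact: bm_cst|exact: bm_cst| |].
    by move=> x; rewrite mul1r.
  split => [x y /=|]; first by rewrite mul1r; lra.
  by rewrite !int_cst; lra.
Qed.

End relaxed_problem.

(** * Contact pairs *)

Section convex3.
Variable R : realType.

Lemma convex3 (D : set R) (F : R -> R) p q s : convex_fun_on D F -> D p -> D s ->
  p < q < s -> (F q - F p) * (s - q) <= (F s - F q) * (q - p).
Proof.
move=> cF Dp Ds /andP[pq qs].
have sp : 0 < s - p by lra.
pose t := (s - q) / (s - p).
have t01 : 0 <= t <= 1.
  by rewrite /t divr_ge0/= ?ler_pdivrMr ?mul1r; lra.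
have := cF p s t Dp Ds t01.
have tsp : t * (s - p) = s - q by rewrite /t divfK// gt_eqF.
have -> : t * p + (1 - t) * s = q by lra.
move=> /(ler_wpM2r (ltW sp)).
have -> : (t * F p + (1 - t) * F s) * (s - p) = (t * (s - p)) * F p + (s - p - t * (s - p)) * F s.
  by ring.
rewrite tsp; lra.
Qed.

End convex3.

Section contact.
Variables (R : realType) (l r L K : R) (C : R -> R -> R) (f g h : R -> R).
Local Notation J x := (l <= x <= r).
Local Notation psi x y := (f x + h x * (y - x) + C x y).
Hypotheses (L0 : 0 <= L) (K0 : 0 <= K)
  (gK : forall x y, `|g x - g y| <= K * `|x - y|)
  (CL : forall x y y', `|C x y - C x y'| <= L * `|y - y'|)
  (Cconv : forall x, J x -> convex_fun_on [set y | J y] (C x))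
  (gpsi : forall x y, J x -> J y -> g y <= psi x y).

Definition contact x y := [/\ J x, J y & g y = psi x y].

(** The multiplier contributes slope at least [L + 1] and the cost takes back at most [L]. As
    [psi x] lies above [g] and touches it at contact points, such growth of [psi x] up to a contact
    point is inherited by [g]. *)
Lemma psi_up x y y' : L + 1 <= h x -> y <= y' -> y' - y <= psi x y' - psi x y.
Proof.
move=> hx yy'; have := CL x y y'.
rewrite (distrC y) (ger0_norm (_ : 0 <= y' - y)) ?subr_ge0// ler_norml => /andP[c1 c2].
have : (L + 1) * (y' - y) <= h x * (y' - y) by rewrite ler_wpM2r// subr_ge0.
by lra.
Qed.

Lemma psi_down x y y' : h x <= - (L + 1) -> y <= y' -> psi x y' - psi x y <= - (y' - y).
Proof.
move=> hx yy'; have := CL x y' y.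
rewrite (ger0_norm (_ : 0 <= y' - y)) ?subr_ge0// ler_norml => /andP[_ c2].
have : h x * (y' - y) <= - (L + 1) * (y' - y) by rewrite ler_wpM2r// subr_ge0.
by lra.
Qed.

Lemma psi_convex3 x p q s : J x -> J p -> J s -> p < q < s ->
  (psi x q - psi x p) * (s - q) <= (psi x s - psi x q) * (q - p).
Proof. by move=> Jx Jp Js pqs; have := convex3 (Cconv Jx) Jp Js pqs; lra. Qed.

(** Some chord of [psi x] starting at [x0] has slope below 1, which by convexity means a right
    derivative below 1. Testing a sequence of chords shrinking to [x0] makes the set of such [x] a
    countable union, hence measurable. For [x0 = r] the condition is false. *)
Definition steep_below x0 x := exists n : nat,
  h x * ((r - x0) / n.+1%:R) + C x (x0 + (r - x0) / n.+1%:R) - C x x0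
    < (r - x0) / n.+1%:R.

(* If some contact point carries a slope above [L + 1], let [x0] be the last
   point that [g] reaches with average slope at least 1 from everywhere on its
   left.  Convexity of [C x] propagates steepness to the right along any contact
   pair straddling [x0], so no such pair exists. *)
Lemma barrier x1 z0 : contact x1 z0 -> L + 1 <= h x1 ->
  exists2 x0, J x0 & forall x y, contact x y ->
    [/\ L + 1 <= h x -> y <= x0, h x <= - (L + 1) -> x0 <= y,
        steep_below x0 x -> x0 <= y & ~ steep_below x0 x -> y <= x0].
Proof.
move=> [Jx1 Jz0 gz0] hx1.
pose W := [set q | [/\ J q, z0 <= q & forall s, z0 <= s <= q -> q - s <= g q - g s]].
have Wz0 : W z0.
  split => // s /andP[zs sz]; have -> : s = z0 by apply/eqP; rewrite eq_le sz.
  by rewrite !subrr.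
have ubW : ubound W r by move=> q [/andP[]].
have supW : has_sup W by split; [exists z0|exists r].
pose x0 := sup W.
have Wle q : W q -> q <= x0 by move=> Wq; apply: ub_le_sup => //; exists r.
have z0x0 : z0 <= x0 by exact: Wle.
have x0r : x0 <= r by apply: ge_sup => //; exists z0.
have Jx0 : J x0 by move/andP: Jz0 => [lz _]; rewrite (le_trans lz z0x0).
(* The supremum has the defining property of [W]: a point of [W] within [e1] of it loses at most
   [(K + 1) * e1 <= e], and [e1 <= x0 - s] keeps that point to the right of [s]. *)
have Wx0 s : z0 <= s <= x0 -> x0 - s <= g x0 - g s.
  move=> /andP[zs]; rewrite le_eqVlt => /predU1P[->|sx0]; first by rewrite !subrr.
  apply/ler_addgt0Pr => e e0.
  pose e1 := Num.min (x0 - s) (e / (K + 1)).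
  have K1 : 0 < K + 1 by rewrite ltr_wpDl.
  have e10 : 0 < e1 by rewrite lt_min subr_gt0 sx0 divr_gt0.
  have [q [Jq zq Wq] qx0] := sup_adherent e10 supW; rewrite -/x0 in qx0.
  have e1s : e1 <= x0 - s by rewrite ge_min lexx.
  have e1e : (K + 1) * e1 <= e.
    by rewrite mulrC -ler_pdivlMr// ge_min lexx orbT.
  have qx : q <= x0 by apply: Wle.
  have := Wq s; have -> : z0 <= s <= q by rewrite zs; lra.
  move=> /(_ isT) h1.
  have := gK x0 q.
  rewrite (ger0_norm (_ : 0 <= x0 - q)) ?subr_ge0// ler_norml => /andP[h2 _].
  have h3 : K * (x0 - q) <= K * e1 by rewrite ler_wpM2l//; lra.
  by lra.
(* Left of [z0], the steep majorant [psi x1], equal to [g] at [z0], carries the growth rate 1 down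
   to [l]. *)
have left p : J p -> p <= x0 -> x0 - p <= g x0 - g p.
  move=> Jp px0; have [zp|pz] := leP z0 p; first by apply: Wx0; rewrite zp.
  have h1 := psi_up hx1 (ltW pz); have h2 := gpsi Jx1 Jp.
  have := Wx0 z0; rewrite lexx z0x0 => /(_ isT) h3.
  by lra.
(* Maximality of [x0]: no point beyond it is reached at rate 1 from every point between. *)
have right y : J y -> x0 < y -> ~ (forall s, x0 <= s -> s < y -> y - s <= g y - g s).
  move=> Jy x0y H; suff /Wle : W y by rewrite leNgt x0y.
  split => //; first by rewrite (le_trans z0x0)// ltW.
  move=> s /andP[zs]; rewrite le_eqVlt => /predU1P[->|sy]; first by rewrite !subrr.
  have [x0s|sx0] := leP x0 s; first exact: H.
  have := Wx0 s; rewrite zs ltW// => /(_ isT).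
  by have := H x0 (lexx _) x0y; lra.
exists x0 => // x y [Jx Jy gy]; split.
- move=> hx; rewrite leNgt; apply/negP => x0y; apply: (right y) => // s x0s sy.
  have Js : J s by move/andP: Jx0 => [? ?]; move/andP: Jy => [? ?]; lra.
  by have := psi_up hx (ltW sy); have := gpsi Jx Js; lra.
- move=> hx; rewrite leNgt; apply/negP => yx0.
  have := psi_down hx (ltW yx0); have := gpsi Jx Jx0; have := left y Jy (ltW yx0).
  by lra.
- move=> [n]; set d := (r - x0) / n.+1%:R => hn.
  rewrite leNgt; apply/negP => yx0.
  have d0 : 0 <= d by rewrite divr_ge0// subr_ge0.
  have dr : d <= r - x0 by rewrite ler_pdivrMr// ler_peMr ?subr_ge0 ?ler1n//.
  have d1 : 0 < d.
    rewrite lt_neqAle d0 andbT; apply/eqP => dE.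
    by move: hn; rewrite -dE mulr0 add0r addr0 subrr ltxx.
  have Jq : J (x0 + d) by move/andP: Jx0 => [? ?]; lra.
  have yq : y < x0 < x0 + d by rewrite yx0 ltrDl.
  (* The chord of [psi x] from [y] to [x0] has slope at least 1 and the next one, to [x0 + d], slope
     below 1, against convexity. *)
  have := psi_convex3 Jx Jy Jq yq.
  have h1 : x0 - y <= psi x x0 - psi x y.
    by have := gpsi Jx Jx0; have := left y Jy (ltW yx0); lra.
  have -> : x0 + d - x0 = d by lra.
  have h2 : (x0 - y) * d <= (psi x x0 - psi x y) * d by rewrite ler_wpM2r// ltW.
  have h3 : (psi x (x0 + d) - psi x x0) * (x0 - y) < d * (x0 - y).
    by rewrite ltr_pM2r ?subr_gt0//; lra.
  by lra.
- move=> nA; rewrite leNgt; apply/negP => x0y; apply: (right y) => // s x0s sy.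
  have Js : J s by move/andP: Jx0 => [? ?]; move/andP: Jy => [? ?]; lra.
  have rx0 : 0 < r - x0 by move/andP: Jy => [? ?]; lra.
  (* All tested chords from [x0] have slope at least 1, so by convexity [psi x] grows at rate at
     least 1 everywhere right of [x0]. A contact at [y > x0] would pass this on to [g], against
     maximality. *)
  have flat u : x0 < u -> exists q, [/\ x0 < q < u, J q & q - x0 <= psi x q - psi x x0].
    move=> x0u; have : 0 < (u - x0) / (r - x0) by rewrite divr_gt0// subr_gt0.
    move=> /ltr_add_invr[n]; rewrite add0r ltr_pdivlMr// mulrC => hn.
    set d := (r - x0) / n.+1%:R in hn.
    have d0 : 0 < d by rewrite divr_gt0.
    have dr : d <= r - x0 by rewrite ler_pdivrMr// ler_peMr ?ler1n// ltW.
    exists (x0 + d); split; [lra|by move/andP: Jx0 => [? ?]; lra|].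
    by rewrite leNgt; apply/negP => hq; apply: nA; exists n; rewrite -/d; lra.
  suff : y - s <= psi x y - psi x s by have := gpsi Jx Js; lra.
  have steep u v : x0 < u -> u < v -> J v -> v - u <= psi x v - psi x u.
    move=> x0u uv Jv; have Ju : J u by move/andP: Jx0 => [? ?];
      move/andP: Jv => [? ?]; lra.
    have [q [/andP[x0q qu] Jq hq]] := flat u x0u.
    have h1 := psi_convex3 Jx Jx0 Ju (introT andP (conj x0q qu)).
    have h2 : u - q <= psi x u - psi x q.
      rewrite -(ler_pM2r (_ : 0 < q - x0)) ?subr_gt0//; apply: le_trans h1.
      by rewrite mulrC ler_wpM2r// subr_ge0 ltW.
    have h3 := psi_convex3 Jx Jq Jv (introT andP (conj qu uv)).
    rewrite -(ler_pM2r (_ : 0 < u - q)) ?subr_gt0//; apply: le_trans h3.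
    by rewrite mulrC ler_wpM2r// subr_ge0 ltW.
  move: x0s; rewrite le_eqVlt => /predU1P[x0s|x0s]; last exact: steep.
  have [q [/andP[x0q qy] Jq hq]] := flat y x0y.
  by have := steep q y x0q qy Jy; rewrite -x0s; lra.
Qed.

End contact.

(** * Optimal relaxed couplings are martingales *)

Section martingale.
Variables (R : realType) (l r : R) (mu nu : probability R R).
Hypotheses (lr : l <= r)
  (muJ : {ae mu, forall x, l <= x <= r}) (nuJ : {ae nu, forall x, l <= x <= r}).
Local Notation pi := (clamp l r).
Implicit Types (P : probability (R * R)%type R) (A : set R).

(** The martingale defect on the event that [X] lies in [A]. Clamping makes the integrand bounded
    everywhere and, under a coupling of [mu] and [nu], changes it only on a null set. *)
Definition drift P A := \int[P]_z (\1_A z.1 * (pi z.2 - pi z.1)).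

Lemma ae_fst P (Q : R -> Prop) : coupling mu nu P -> {ae mu, forall x, Q x} ->
  {ae P, forall z, Q z.1}.
Proof.
move=> [P1 _] [N [mN N0 QN]]; exists (fst @^-1` N); split.
- by rewrite -[X in measurable X]setTI; exact: measurable_fst.
- by rewrite P1.
- by move=> z; exact: QN.
Qed.

Lemma ae_snd P (Q : R -> Prop) : coupling mu nu P -> {ae nu, forall x, Q x} ->
  {ae P, forall z, Q z.2}.
Proof.
move=> [_ P2] [N [mN N0 QN]]; exists (snd @^-1` N); split.
- by rewrite -[X in measurable X]setTI; exact: measurable_snd.
- by rewrite P2.
- by move=> z; exact: QN.
Qed.

Lemma ae_clamp P : coupling mu nu P ->
  {ae P, forall z, (l <= z.1 <= r) /\ (l <= z.2 <= r)}.
Proof.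
move=> cP; have := ae_fst cP muJ; have := ae_snd cP nuJ.
by apply: filterS2 => z h2 h1.
Qed.

Lemma int_fst_set P A (F G : R * R -> R) : measurable A ->
  measurable_fun setT F -> bm G -> {ae P, forall z, F z = G z} ->
  (\int[P]_(z in fst @^-1` A) (F z)%:E)%E = (\int[P]_z (\1_A z.1 * G z))%:E.
Proof.
move=> mA mF bG FG.
have mD : measurable (fst @^-1` A : set (R * R)).
  by rewrite -[X in measurable X]setTI; exact: measurable_fst.
have b1 : bm (fun z : R * R => \1_A z.1 : R) by exact: (@bm_fst R \1_A (bm_indic R mA)).
rewrite -bm_integralE; last exact: bmM.
transitivity (\int[P]_(z in fst @^-1` A) (G z)%:E)%E.
  apply: ae_eq_integral => //.
  - by apply/measurable_EFinP; exact: measurable_funTS.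
  - by apply/measurable_EFinP; apply: measurable_funTS; case: bG.
  - by apply: filterS FG => z /= -> _.
rewrite integral_mkcond; apply: eq_integral => z _.
rewrite patchE indicE; case: ifPn => zA.
  by rewrite mem_set ?mul1r//; exact: set_mem zA.
rewrite memNset ?mul0r// => Az; move/negP: zA; apply; exact: mem_set.
Qed.

Lemma bm_clamp_fst : bm (fun z : R * R => pi z.1).
Proof. exact: bm_fst (pi_bm lr). Qed.

Lemma bm_clamp_snd : bm (fun z : R * R => pi z.2).
Proof. exact: bm_snd (pi_bm lr). Qed.

Lemma bm_indic_fst A : measurable A -> bm (fun z : R * R => \1_A z.1 : R).
Proof. by move=> mA; exact: (@bm_fst R \1_A (bm_indic R mA)). Qed.

Lemma driftE P A : measurable A ->
  drift P A = \int[P]_z (\1_A z.1 * pi z.2) - \int[P]_z (\1_A z.1 * pi z.1).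
Proof.
move=> mA; have b1 := bm_indic_fst mA.
rewrite -bm_intB.
- by congr (Rintegral _ _ _); apply/funext => z; rewrite mulrBr.
- by apply: bmM => //; exact: bm_clamp_snd.
- by apply: bmM => //; exact: bm_clamp_fst.
Qed.

Lemma mart_coupling_drift P : mart_coupling mu nu P <->
  coupling mu nu P /\ forall A, measurable A -> drift P A = 0.
Proof.
have clampE : coupling mu nu P ->
    {ae P, forall z : R * R, z.1 = pi z.1} /\ {ae P, forall z : R * R, z.2 = pi z.2}.
  move=> cP; split; apply: filterS (ae_clamp cP) => z [z1 z2];
    by rewrite clamp_id.
split.
  move=> [P1 P2 _ PM]; have cP : coupling mu nu P by [].
  split => // A mA; have [E1 E2] := clampE cP.
  have := PM A mA.
  rewrite (int_fst_set mA measurable_snd bm_clamp_snd E2).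
  rewrite (int_fst_set mA measurable_fst bm_clamp_fst E1).
  by move=> [E]; rewrite driftE// E subrr.
move=> [cP dP]; have [E1 E2] := clampE cP; have [P1 P2] := cP.
split => //.
  apply/integrableP; split; first by apply/measurable_EFinP; exact: measurable_snd.
  rewrite (_ : integral _ _ _ = \int[P]_z `|pi z.2|%:E)%E; last first.
    apply: ae_eq_integral => //.
    - by apply: measurableT_comp => //; apply/measurable_EFinP;
      exact: measurable_snd.
    - apply/measurable_EFinP; apply: measurableT_comp => //.
      by case: bm_clamp_snd.
    - by apply: filterS E2 => z /= {1}-> _.
  have [_ [M piM]] := bm_clamp_snd.
  rewrite bm_integralE ?ltry//; split; last by exists M => z; rewrite normr_id.
  by apply: measurableT_comp => //; case: bm_clamp_snd.
move=> A mA.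
rewrite (int_fst_set mA measurable_snd bm_clamp_snd E2).
rewrite (int_fst_set mA measurable_fst bm_clamp_fst E1).
by congr EFin; apply/eqP; rewrite -subr_eq0 -driftE// dP.
Qed.

Lemma drift0_bm P k : (forall A, measurable A -> drift P A = 0) -> bm k ->
  \int[P]_z (k z.1 * (pi z.2 - pi z.1)) = 0.
Proof.
move=> d0 bk; have bd := drift_bm lr.
have bkd := slope_drift_bm lr bk.
apply/eqP; rewrite -normr_le0; apply/ler_addgt0Pr => e e0; rewrite add0r.
(* An error in [k] is multiplied by at most [r - l]; the added 1 avoids dividing by zero when
   [l = r]. *)
have c0 : 0 < r - l + 1 by rewrite ltr_wpDl// subr_ge0.
have e'0 : 0 < e / (r - l + 1) by rewrite divr_gt0.
have [n [a [A [mA kA]]]] := bm_approx bk e'0.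
pose F i (z : R * R) := a i * (\1_(A i) z.1 * (pi z.2 - pi z.1)).
have bF i : bm (F i).
  by apply: bmZ; apply: (@bmM _ _ _ (fun z => \1_(A i) z.1)) => //;
    exact: bm_indic_fst.
have bS : bm (fun z => \sum_(i < n) F i z) by exact: bm_sum.
have S0 : \int[P]_z \sum_(i < n) F i z = 0.
  rewrite bm_int_sum// big1// => i _; rewrite bm_intZ; last first.
    by apply: (@bmM _ _ _ (fun z => \1_(A i) z.1)) => //; exact: bm_indic_fst.
  by have := d0 _ (mA i); rewrite /drift => ->; rewrite mulr0.
have close z : `|k z.1 * (pi z.2 - pi z.1) - \sum_(i < n) F i z| <= e.
  have -> : \sum_(i < n) F i z = (\sum_(i < n) a i * \1_(A i) z.1) * (pi z.2 - pi z.1).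
    by rewrite mulr_suml; apply: eq_bigr => i _; rewrite /F mulrA.
  rewrite -mulrBl normrM (le_trans (ler_pM _ _ (kA z.1) (clamp_dist lr _ _)))//.
  by rewrite mulrAC ler_pdivrMr// ler_wpM2l ?ltW// ltrDl.
have be : bm (fun _ : R * R => e) by exact: bm_cst.
have h1 : \int[P]_z (k z.1 * (pi z.2 - pi z.1)) <= \int[P]_z \sum_(i < n) F i z + e.
  rewrite -[X in _ + X](int_cst P) -bm_intD//; apply: bm_int_le => // [|z];
    first exact: bmD.
  by move: (close z); rewrite ler_norml => /andP[]; lra.
have h2 : \int[P]_z \sum_(i < n) F i z <= \int[P]_z (k z.1 * (pi z.2 - pi z.1)) + e.
  rewrite -[X in _ + X](int_cst P) -bm_intD//; apply: bm_int_le => // [|z];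
    first exact: bmD.
  by move: (close z); rewrite ler_norml => /andP[]; lra.
by rewrite ler_norml; apply/andP; split; lra.
Qed.

(** The convex order speaks of functions convex on the whole line, the integration lemmas of bounded
    ones. Both measures live on [[l, r]], where [xi] and its bounded substitute [phi] coincide. *)
Lemma convex_order_bm (xi phi : R -> R) : convex_order mu nu ->
  convex_fun_on setT xi -> lipf xi -> bm phi ->
  (forall x, l <= x <= r -> xi x = phi x) ->
  \int[mu]_x phi x <= \int[nu]_x phi x.
Proof.
move=> [_ [_ co]] cxi lxi bphi xiphi; rewrite -lee_fin -!bm_integralE//.
have E (m : probability R R) : {ae m, forall x, l <= x <= r} ->
    (\int[m]_x (phi x)%:E = \int[m]_x (xi x)%:E)%E.
  move=> mJ; apply: ae_eq_integral => //.
  - by apply/measurable_EFinP; case: bphi.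
  - by apply/measurable_EFinP; exact: lipf_measurable.
  - by apply: filterS mJ => x /xiphi -> _.
by rewrite !E//; exact: co.
Qed.

End martingale.

Section core.
Variables (R : realType) (l r L : R) (C : R -> R -> R) (mu nu : probability R R).
Hypotheses (lr : l <= r) (L0 : 0 <= L)
  (CL : forall x y x' y', `|C x y - C x' y'| <= L * (`|x - x'| + `|y - y'|))
  (Cp : forall x y, C x y = C (clamp l r x) (clamp l r y))
  (Cconv : forall x, l <= x <= r -> convex_fun_on [set y | l <= y <= r] (C x))
  (muJ : {ae mu, forall x, l <= x <= r}) (nuJ : {ae nu, forall x, l <= x <= r})
  (cmn : convex_order mu nu).
Local Notation pi := (clamp l r).

Lemma int_clamp : \int[mu]_x pi x = \int[nu]_x pi x.
Proof.
have bpi := pi_bm lr.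
apply/eqP; rewrite eq_le; apply/andP; split.
  apply: (@convex_order_bm _ l r mu nu muJ nuJ (fun x => x)) => //.
  - exact: lipf_id.
  - by move=> x Jx; rewrite clamp_id.
have := @convex_order_bm _ l r mu nu muJ nuJ (fun x => - x) (fun x => -1 * pi x) cmn.
rewrite !bm_intZ// !mulN1r lerN2; apply.
- by move=> x y t _ _ _; lra.
- by apply: lipfN; exact: lipf_id.
- exact: bmZ.
- by move=> x Jx; rewrite clamp_id// mulN1r.
Qed.

Section optimizer.
Variables (K : R) (f g h : R -> R) (P : probability (R * R)%type R).
Hypotheses (K0 : 0 <= K) (gK : forall x y, `|g x - g y| <= K * `|x - y|)
  (bf : bm f) (bg : bm g) (bh : bm h) (hH : forall x, `|h x| <= L + 2)
  (fgh : forall x y, g y - f x - h x * (pi y - pi x) <= C x y)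
  (cP : coupling mu nu P)
  (tight : {ae P, forall z,
     C z.1 z.2 + h z.1 * (pi z.2 - pi z.1) + f z.1 - g z.2 = 0})
  (hopt : forall k, bm k -> (forall x, `|k x| <= L + 2) ->
     \int[P]_z ((k z.1 - h z.1) * (pi z.2 - pi z.1)) <= 0).
Local Notation drift := (drift l r P).

Lemma bm_drift A : measurable A -> bm (fun z : R * R => \1_A z.1 * (pi z.2 - pi z.1)).
Proof.
by move=> mA; apply: (slope_drift_bm lr (k := \1_A)); exact: bm_indic.
Qed.

Lemma driftU A B : measurable A -> measurable B -> A `&` B = set0 ->
  drift (A `|` B) = drift A + drift B.
Proof.
move=> mA mB AB; rewrite /drift -bm_intD; [|exact: bm_drift|exact: bm_drift].
congr (Rintegral _ _ _); apply/funext => z; rewrite -mulrDl; congr (_ * _).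
rewrite !indicE in_setU.
have [zA|zA] := boolP (z.1 \in A); have [zB|zB] := boolP (z.1 \in B);
  rewrite ?addr0 ?add0r//.
suff : (A `&` B) z.1 by rewrite AB.
by split; apply: set_mem.
Qed.

Lemma measurable_le_slope t : measurable [set x | t <= h x].
Proof.
rewrite (_ : [set x | t <= h x] = h @^-1` `[t, +oo[%classic).
  by rewrite -[X in measurable X]setTI; case: bh => mh _; apply: mh => //;
    exact: measurable_itv.
by apply/seteqP; split => x; rewrite /= in_itv/= andbT.
Qed.

Lemma measurable_ge_slope t : measurable [set x | h x <= t].
Proof.
rewrite (_ : [set x | h x <= t] = h @^-1` `]-oo, t]%classic).
  by rewrite -[X in measurable X]setTI; case: bh => mh _; apply: mh => //;
    exact: measurable_itv.
by apply/seteqP; split => x; rewrite /= in_itv/=.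
Qed.

(** First-order condition: moving [h] by [s] on [A] respects the bound [L + 2], so optimality of [h]
    fixes the sign of the drift. *)
Lemma drift_sign A s : measurable A -> (forall x, A x -> `|h x + s| <= L + 2) ->
  s * drift A <= 0.
Proof.
move=> mA As; have bA : bm (\1_A : R -> R) by exact: bm_indic.
have bk : bm (fun x => h x + s * \1_A x) by apply: bmD => //; exact: bmZ.
have := hopt bk; rewrite /drift -bm_intZ; last exact: bm_drift.
have -> : (fun z : R * R => (h z.1 + s * \1_A z.1 - h z.1) * (pi z.2 - pi z.1)) =
          (fun z => s * (\1_A z.1 * (pi z.2 - pi z.1))).
  by apply/funext => z; rewrite [X in X - _]addrC addrK mulrA.
apply => x; rewrite indicE; case: (boolP (x \in A)) => [/set_mem Ax|_].
  by rewrite mulr1; exact: As.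
by rewrite mulr0 addr0.
Qed.

Lemma drift_le0 A : measurable A -> (forall x, A x -> h x <= L + 1) -> drift A <= 0.
Proof.
move=> mA Ah; have := @drift_sign A 1 mA; rewrite mul1r; apply => x Ax.
have := Ah x Ax; have := hH x; rewrite !ler_norml => /andP[? ?] ?.
by apply/andP; split; lra.
Qed.

Lemma drift_ge0 A : measurable A -> (forall x, A x -> - (L + 1) <= h x) -> 0 <= drift A.
Proof.
move=> mA Ah; have := @drift_sign A (-1) mA; rewrite mulN1r oppr_le0; apply => x Ax.
have := Ah x Ax; have := hH x; rewrite !ler_norml => /andP[? ?] ?.
by apply/andP; split; lra.
Qed.

Let up := [set x | L + 1 <= h x].
Let down := [set x | h x <= - (L + 1)].

Lemma ae_contact : {ae P, forall z, contact l r C f g h z.1 z.2}.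
Proof.
have := ae_clamp muJ nuJ cP; have := tight.
apply: filterS2 => z t [z1 z2]; split => //.
by move: t; rewrite !clamp_id//; lra.
Qed.

Lemma measurable_steep_below x0 : measurable [set x | steep_below r C h x0 x].
Proof.
have mC y : measurable_fun setT (C ^~ y).
  apply: lipf_measurable; exists L => x x'.
  by rewrite (le_trans (CL _ _ _ _))// subrr normr0 addr0.
pose F n x := h x * ((r - x0) / n.+1%:R) + C x (x0 + (r - x0) / n.+1%:R) - C x x0.
rewrite (_ : [set x | _] =
    \bigcup_n (F n @^-1` `]-oo, ((r - x0) / n.+1%:R)[%classic)).
  apply: bigcupT_measurable => n; rewrite -[X in measurable X]setTI.
  have mF : measurable_fun setT (F n).
    apply: measurable_funB => //; apply: measurable_funD => //.
    by apply: measurable_funM => //; case: bh.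
  by apply: mF => //; exact: measurable_itv.
apply/seteqP; split => x.
  by move=> [n hn]; exists n => //=; rewrite in_itv/=.
by move=> [n _ /=]; rewrite in_itv/= => hn; exists n.
Qed.

Lemma drift_up : drift up = 0.
Proof.
have mup : measurable up by exact: measurable_le_slope.
have mdown : measurable down by exact: measurable_ge_slope.
apply/eqP; rewrite eq_le; apply/andP; split; last first.
  by apply: drift_ge0 => // x; rewrite /up /=; have := L0; lra.
rewrite leNgt; apply/negP => dup.
(* Positive drift on [up] forces a contact pair with [L + 1 <= h], the seed of the barrier. *)
have [[x1 z0] [ct hx1]] : exists z : R * R, contact l r C f g h z.1 z.2 /\ L + 1 <= h z.1.
  apply: contrapT => nex; move: dup; rewrite (_ : drift up = 0) ?ltxx//.
  rewrite /drift -[RHS](int_cst P 0); apply: bm_int_ae_eq;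
    [exact: bm_drift|exact: bm_cst|].
  apply: filterS ae_contact => z cz; rewrite indicE memNset ?mul0r// => hz.
  by apply: nex; exists z.
have CL2 x y y' : `|C x y - C x y'| <= L * `|y - y'|.
  by rewrite (le_trans (CL _ _ _ _))// subrr normr0 add0r.
have gpsi x y : l <= x <= r -> l <= y <= r -> g y <= f x + h x * (y - x) + C x y.
  by move=> Jx Jy; have := fgh x y; rewrite !clamp_id//; lra.
have [x0 Jx0 bar] := barrier K0 gK CL2 Cconv gpsi ct hx1.
(* Points with a moderate multiplier whose contacts stay left of [x0]. Their drift is 0, so the part
   of the coupling ending left of [x0] has the drift of [up] alone. *)
pose rest := ~` (up `|` down `|` [set x | steep_below r C h x0 x]).
have mrest : measurable rest.
  apply: measurableC; apply: measurableU; last exact: measurable_steep_below.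
  exact: measurableU.
have dE : drift rest = 0.
  apply/eqP; rewrite eq_le; apply/andP; split;
    [apply: drift_le0|apply: drift_ge0] => // x nx.
    by rewrite leNgt; apply/negP => hx; apply: nx; left; left; exact: ltW.
  by rewrite leNgt; apply/negP => hx; apply: nx; left; right; exact: ltW.
pose phi x := Num.max 0 (x0 - pi x).
have bphi : bm phi.
  apply: bm_max; first exact: bm_cst.
  by apply: bmB; [exact: bm_cst|exact: pi_bm].
have co : \int[mu]_x phi x <= \int[nu]_x phi x.
  apply: (@convex_order_bm _ l r mu nu muJ nuJ (fun x => Num.max 0 (x0 - x))) => //.
  - move=> x y t _ _ /andP[t0 t1]; rewrite ge_max; apply/andP; split.
      by rewrite addr_ge0// mulr_ge0// ?subr_ge0// le_max lexx.
    have hx : x0 - x <= Num.max 0 (x0 - x) by rewrite le_max lexx orbT.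
    have hy : x0 - y <= Num.max 0 (x0 - y) by rewrite le_max lexx orbT.
    have h1 := ler_wpM2l t0 hx.
    have h2 : (1 - t) * (x0 - y) <= (1 - t) * Num.max 0 (x0 - y).
      by rewrite ler_wpM2l// subr_ge0.
    by lra.
  - exists 1 => x y; rewrite mul1r (le_trans (max_lip _ _ _))//.
    have -> : x0 - x - (x0 - y) = - (x - y) by lra.
    by rewrite normrN.
  - by move=> x Jx; rewrite /phi clamp_id.
(* On [up] and [rest], contacts satisfy [y <= x0], so [phi y - phi x <= x - y]; elsewhere [x0 <= y],
   so [phi y = 0 <= phi x]. The right side integrates to [- drift up < 0], the left side to
   something nonnegative by convex order. *)
have : \int[P]_z (phi z.2 - phi z.1) <=
    \int[P]_z (- (\1_up z.1 * (pi z.2 - pi z.1)) - \1_rest z.1 * (pi z.2 - pi z.1)).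
  have b1 := bm_drift mup; have b2 := bm_drift mrest.
  apply: bm_int_ae_le.
  - by apply: (@bmB _ _ _ (fun z => phi z.2)); [exact: bm_snd|exact: bm_fst].
  - by apply: bmB => //; exact: bmN.
  apply: filterS ae_contact => -[x y] /= cz; have [Jx Jy _] := cz.
  have [b_up b_down b_steep b_flat] := bar x y cz.
  rewrite /phi !clamp_id// !indicE.
  have [xu|xnu] := boolP (x \in up).
    rewrite memNset; last by move=> nx; apply: nx; left; left; exact: set_mem xu.
    have yx0 := b_up (set_mem xu).
    by rewrite mul1r mul0r subr0 (max_r (_ : 0 <= x0 - y)) ?subr_ge0// /Num.max;
      case: ltP; lra.
  have [xr|xnr] := boolP (x \in rest).
    have yx0 : y <= x0 by apply: b_flat => sx; apply: (set_mem xr); right.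
    by rewrite mul1r mul0r (max_r (_ : 0 <= x0 - y)) ?subr_ge0// /Num.max;
      case: ltP; lra.
  have x0y : x0 <= y.
    have : ~ rest x by move=> rx; move/negP: xnr; apply; exact: mem_set.
    move=> /contrapT[[xu|]|].
    - by move/negP: xnu; case; exact: mem_set.
    - exact: b_down.
    - exact: b_steep.
  by rewrite !mul0r (max_l (_ : x0 - y <= 0)) ?subr_le0// /Num.max; case: ltP; lra.
rewrite bm_intB; [|exact: bm_snd|exact: bm_fst].
rewrite (int_snd cP)// (int_fst cP)//.
rewrite bm_intB; [|by apply: bmN; exact: bm_drift|exact: bm_drift].
rewrite -/(drift rest) dE.
have -> : \int[P]_z (- (\1_up z.1 * (pi z.2 - pi z.1))) = - drift up.
  rewrite -[RHS]mulN1r /drift -bm_intZ; last exact: bm_drift.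
  by congr (Rintegral _ _ _); apply/funext => z; rewrite mulN1r.
by lra.
Qed.

(** Every measurable part of [up] has nonnegative drift and the whole has none, so each part has
    none. Equal means make the total drift vanish, which gives the same for [down]; in between, the
    two sign bounds meet. *)
Lemma drift_eq0 A : measurable A -> drift A = 0.
Proof.
move=> mA.
have mup : measurable up by exact: measurable_le_slope.
have mdown : measurable down by exact: measurable_ge_slope.
have split_drift B : measurable B -> drift B = drift (B `&` A) + drift (B `\` A).
  move=> mB; rewrite -driftU; [|exact: measurableI|exact: measurableD|].
    by rewrite setUIDK.
  by apply/seteqP; split => // x [[_ ?] []].
have split_A B : measurable B -> drift A = drift (A `&` B) + drift (A `\` B).
  move=> mB; rewrite -driftU; [|exact: measurableI|exact: measurableD|].
    by rewrite setUIDK.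
  by apply/seteqP; split => // x [[_ ?] []].
have d_up : drift (up `&` A) = 0.
  have := split_drift _ mup; rewrite drift_up.
  have : 0 <= drift (up `&` A).
    by apply: drift_ge0 => [|x [] +]; [exact: measurableI|rewrite /up /=;
      have := L0; lra].
  have : 0 <= drift (up `\` A).
    by apply: drift_ge0 => [|x [] +]; [exact: measurableD|rewrite /up /=;
      have := L0; lra].
  by lra.
have d0 B : measurable B -> (forall x, B x -> ~ up x /\ ~ down x) -> drift B = 0.
  move=> mB Bx; apply/eqP; rewrite eq_le; apply/andP; split.
    apply: drift_le0 => // x /Bx[nx _]; rewrite leNgt; apply/negP => hx.
    by apply: nx; exact: ltW.
  apply: drift_ge0 => // x /Bx[_ nx]; rewrite leNgt; apply/negP => hx.
  by apply: nx; exact: ltW.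
have dT : drift setT = 0.
  rewrite driftE// -[X in _ - X](_ : \int[mu]_x pi x = _).
    rewrite int_clamp -(int_snd cP); last exact: pi_bm.
    by apply/eqP; rewrite subr_eq0; apply/eqP; congr (Rintegral _ _ _);
      apply/funext => z; rewrite indicT mul1r.
  rewrite -(int_fst cP); last exact: pi_bm.
  by congr (Rintegral _ _ _); apply/funext => z; rewrite indicT mul1r.
have d_down' : drift down = 0.
  have mud : measurable (up `|` down) by exact: measurableU.
  have := driftU mup mdown; rewrite drift_up add0r => H.
  have ud0 : up `&` down = set0.
    by apply/seteqP; split => // x []; rewrite /up /down /=; have := L0; lra.
  rewrite -(H ud0); have := driftU mud (measurableC mud) (setICr _).
  rewrite setUCr dT (d0 (~` _)) ?addr0//; first exact: measurableC.
  by move=> x nx; split => ?; apply: nx; [left|right].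
have d_down : drift (down `&` A) = 0.
  have := split_drift _ mdown; rewrite d_down'.
  have : drift (down `&` A) <= 0.
    by apply: drift_le0 => [|x [] +]; [exact: measurableI|rewrite /down /=;
      have := L0; lra].
  have : drift (down `\` A) <= 0.
    by apply: drift_le0 => [|x [] +]; [exact: measurableD|rewrite /down /=;
      have := L0; lra].
  by lra.
rewrite (split_A _ mup) setIC d_up add0r.
have mAu : measurable (A `\` up) by exact: measurableD.
rewrite -(setUIDK (A `\` up) down) driftU.
- rewrite (d0 (_ `\` _)) ?addr0.
  + suff -> : (A `\` up) `&` down = down `&` A by [].
    apply/seteqP; split => x; first by move=> [[]].
    by move=> [dx Ax]; split => //; split => //; move: dx; rewrite /up /down /=;
      have := L0; lra.
  + exact: measurableD.
  + by move=> x [[]].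
- exact: measurableI.
- exact: measurableD.
- by apply/seteqP; split => // x [[_ ?] []].
Qed.

End optimizer.

Theorem core_duality : exists f g h (P : probability (R * R)%type R),
  [/\ [/\ lipf f, lipf g, bm f, bm g & bm h],
      forall x y, g y - f x - h x * (pi y - pi x) <= C x y,
      mart_coupling mu nu P &
      \int[P]_z C z.1 z.2 = \int[nu]_y g y - \int[mu]_x f x].
Proof.
(* The barrier argument concerns slopes beyond [L + 1]; the extra 1 leaves room to
   perturb [h] in either direction where it is less steep. *)
pose H := L + 2; have H0 : 0 <= H by rewrite addr_ge0.
have [g pg gmax] := dual_value_max mu nu lr L0 H0 CL Cp.
pose f := envelope l r H C g; pose h := slope l r H C g.
have bf : bm f by exact: (envelope_bm lr L0 H0 CL Cp).
have bg : bm g by exact: (potential_bm lr pg).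
have tg x : tangent l r H C g x (f x) (h x) by exact: (slope_tangent lr L0 H0 CL Cp).
have hH x : `|h x| <= L + 2 by have [+ _] := tg x; rewrite ler_norml.
have bh : bm h by split; [exact: (slope_measurable lr L0 H0 CL Cp)|exists (L + 2)].
have fgh x y : g y - f x - h x * (pi y - pi x) <= C x y.
  by have [_ /(_ y)] := tg x; lra.
have lf : lipf f by exact: (lipf_envelope lr L0 H0 CL Cp).
have lg : lipf g by exact: potential_lipf pg.
have Dmax f' g' h' : bm f' -> bm g' -> (forall x, `|h' x| <= H) ->
    (forall x y, g' y - f' x - h' x * (pi y - pi x) <= C x y) ->
    \int[nu]_y g' y - \int[mu]_x f' x <= dual_value l r H C mu nu g.
  move=> bf' bg' hH' adm.
  have [g2 pg2] := admissible_le_dual mu nu lr L0 H0 CL Cp bf' bg' hH' adm.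
  by move=> /le_trans; apply; exact: gmax.
have [P [cP hopt Pval]] := relaxed_optimizer lr L0 CL Cp bf bg bh hH fgh erefl Dmax.
have bC := cost_bm lr L0 CL Cp.
have bhd := slope_drift_bm lr bh.
have b1 : bm (fun z : R * R => C z.1 z.2 + h z.1 * (pi z.2 - pi z.1)) by exact: bmD.
have b2 : bm (fun z : R * R => C z.1 z.2 + h z.1 * (pi z.2 - pi z.1) + f z.1).
  by apply: bmD => //; exact: bm_fst.
have bs : bm (fun z : R * R => C z.1 z.2 + h z.1 * (pi z.2 - pi z.1) + f z.1 - g z.2).
  by apply: bmB => //; exact: bm_snd.
(* The slack is nonnegative by feasibility, and the bound on the value of [P] makes its integral at
   most 0. *)
have tight : {ae P, forall z,
    C z.1 z.2 + h z.1 * (pi z.2 - pi z.1) + f z.1 - g z.2 = 0}.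
  apply: bm_int_le0 => // [z|]; first by have := fgh z.1 z.2; lra.
  rewrite bm_intB//; last exact: bm_snd.
  rewrite bm_intD//; last exact: bm_fst.
  rewrite (int_fst cP)// (int_snd cP)//.
  by move: Pval; rewrite /dual_value -/f; lra.
have [gK _] := pg.
have K0 : 0 <= H + L by rewrite addr_ge0.
have d0 := drift_eq0 K0 gK bh hH fgh cP tight hopt.
exists f, g, h, P; split => //.
  by apply/(mart_coupling_drift lr muJ nuJ).
have hd0 := drift0_bm lr d0 bh.
have : \int[P]_z (C z.1 z.2 + h z.1 * (pi z.2 - pi z.1) + f z.1 - g z.2) = 0.
  rewrite -[RHS](int_cst P 0); apply: bm_int_ae_eq => //; exact: bm_cst.
rewrite bm_intB//; last exact: bm_snd.
rewrite bm_intD//; last exact: bm_fst.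
rewrite bm_intD// hd0 (int_fst cP)// (int_snd cP)//.
by lra.
Qed.

End core.

(** * Reduction to a globally Lipschitz convex cost *)

Section support.
Variable R : realType.
Implicit Types m mu nu : probability R R.

(** A point off the support lies in a null interval with rational ends, and there are countably many
    of these. *)
Lemma ae_msupport m : {ae m, forall x, msupport m x}.
Proof.
pose I (q : rat * rat) : set R := `]ratr q.1, ratr q.2[%classic.
pose F n := if unpickle n is Some q then
  if m (I q) == 0%E then I q else set0 else set0.
have : m.-negligible (\bigcup_n F n).
  apply: negligible_bigcup => n; rewrite /F; case: unpickle => [q|];
    last exact: negligible_set0.
  case: eqP => [mq|_]; last exact: negligible_set0.
  by exists (I q); split => //; exact: measurable_itv.
apply: negligibleS => x /= /existsNP[e /not_implyP[e0 /negP]].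
rewrite -leNgt => me.
have ritv (p q : R) : p < q -> exists a : rat, p < ratr a < q.
  by move=> /rat_in_itvoo[a]; rewrite in_itv/= => ?; exists a.
have [|p /andP[p1 p2]] := ritv (x - e) x; first by rewrite ltrBlDr ltrDl.
have [|q /andP[q1 q2]] := ritv x (x + e); first by rewrite ltrDl.
have [n nE] : exists n, unpickle n = Some (p, q) by exists (pickle (p, q));
  rewrite pickleK.
exists n => //; rewrite /F nE ifT; first by rewrite /I /= in_itv/= p2 q1.
rewrite -measure_le0; apply: le_trans me; apply: le_measure; rewrite ?inE.
- exact: measurable_itv.
- have -> : [set z | x - e < z < x + e] = `]x - e, x + e[%classic.
    by apply/seteqP; split => z; rewrite /= in_itv.
  exact: measurable_itv.
- move=> z; rewrite /I /= in_itv/= => /andP[? ?].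
  by rewrite (lt_trans p1)//= (lt_trans _ q2).
Qed.

Lemma conv_hull_itv m : compact (conv_hull (msupport m)) ->
  exists l r, l <= r /\ conv_hull (msupport m) = [set x | l <= x <= r].
Proof.
set J := conv_hull _ => cJ.
have [x0 Sx0] : exists x, msupport m x.
  apply: contrapT => /forallNP nS; have [N [mN N0 SN]] := ae_msupport m.
  have NT : N = setT by apply/seteqP; split => // x _; apply: SN; exact: nS.
  by move: N0; rewrite NT probability_setT => -[/eqP]; rewrite oner_eq0.
have Jx0 : J x0 by exists x0, x0; rewrite lexx.
have J0 : J !=set0 by exists x0.
have [r /set_mem Jr rmax] := compact_EVT_max J0 cJ (continuous_subspaceT (fun x => @cvg_id _ (nbhs x))).
have cN : {within J, continuous (fun x : R => - x)}.
  by apply: continuous_subspaceT => x; exact: oppr_continuous.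
have [l /set_mem Jl lmin] := compact_EVT_max J0 cJ cN.
have lx x : J x -> l <= x by move=> Jx; rewrite -lerN2; apply: lmin; exact: mem_set.
have xr x : J x -> x <= r by move=> Jx; apply: rmax; exact: mem_set.
exists l, r; split; first exact: lx.
apply/seteqP; split => x /=; first by move=> Jx; rewrite lx// xr.
move=> /andP[lx' xr']; have [a [_ [Sa _ /andP[al _]]]] := Jl.
have [_ [b [_ Sb /andP[_ rb]]]] := Jr.
by exists a, b; split => //; rewrite (le_trans al lx') (le_trans xr' rb).
Qed.

Lemma ae_conv_hull m : {ae m, forall x, conv_hull (msupport m) x}.
Proof. by apply: filterS (ae_msupport m) => x Sx; exists x, x; rewrite lexx. Qed.

(** The distance to [[l, r]] is convex with [nu]-integral 0, so its [mu]-integral is 0 as well. *)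
Lemma convex_order_support mu nu l r : l <= r -> convex_order mu nu ->
  {ae nu, forall x, l <= x <= r} -> {ae mu, forall x, l <= x <= r}.
Proof.
move=> lr [_ [_ co]] nuJ.
pose xi x := Num.max 0 (Num.max (l - x) (x - r)).
have xi_ge x : [/\ 0 <= xi x, l - x <= xi x & x - r <= xi x].
  by rewrite /xi !le_max !lexx !orbT.
have xi_le x b : 0 <= b -> l - x <= b -> x - r <= b -> xi x <= b.
  by move=> b0 b1 b2; rewrite /xi !ge_max b0 b1 b2.
have cxi : convex_fun_on setT xi.
  move=> x y t _ _ /andP[t0 t1].
  have [x0 x1 x2] := xi_ge x; have [y0 y1 y2] := xi_ge y.
  have t1' : 0 <= 1 - t by rewrite subr_ge0.
  apply: xi_le.
  - by rewrite addr_ge0// mulr_ge0.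
  - by have := ler_wpM2l t0 x1; have := ler_wpM2l t1' y1; lra.
  - by have := ler_wpM2l t0 x2; have := ler_wpM2l t1' y2; lra.
have lxi : lipf xi.
  exists 1 => x y; rewrite mul1r.
  have key u v : xi u <= xi v + `|u - v|.
    have [v0 v1 v2] := xi_ge v; apply: xi_le; first by rewrite addr_ge0.
      by have := ler_norm (v - u); rewrite distrC; lra.
    by have := ler_norm (u - v); lra.
  rewrite ler_norml; apply/andP; split; last by have := key x y; lra.
  by have := key y x; rewrite distrC; lra.
have mxi : measurable_fun setT (EFin \o xi).
  by apply/measurable_EFinP; exact: lipf_measurable.
have xiJ x : xi x = 0 <-> l <= x <= r.
  have [x0 x1 x2] := xi_ge x; split.
    by move=> E; move: x1 x2; rewrite E subr_le0 subr_le0 => -> ->.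
  by move=> /andP[? ?]; apply/eqP; rewrite eq_le x0 andbT; apply: xi_le; lra.
have nu0 : (\int[nu]_x (xi x)%:E = 0)%E.
  rewrite -[RHS](integral0 nu setT); apply: ae_eq_integral => //.
  by apply: filterS nuJ => x /xiJ -> _.
have mu0 : (\int[mu]_x `|(xi x)%:E| = 0)%E.
  apply/eqP; rewrite eq_le; apply/andP; split; last exact: integral_ge0.
  rewrite -[leRHS]nu0; apply: le_trans (co xi cxi).
  by rewrite le_eqVlt; apply/orP; left; apply/eqP; apply: eq_integral => x _;
    rewrite gee0_abs// lee_fin; have [] := xi_ge x.
move/(ae_eq_integral_abs mu measurableT mxi) : mu0; apply: filterS => x /= h.
by apply/xiJ; have [] := h I.
Qed.

End support.

Section convexified_cost.
Variables (R : realType) (l r L : R) (c : R -> R -> R) (u : R -> R) (S : set R).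
Local Notation pi := (clamp l r).
Local Notation J := [set x | l <= x <= r].
Hypotheses (lr : l <= r) (L0 : 0 <= L) (S0 : S !=set0) (SJ : S `<=` J)
  (cL : forall x y x' y', J x -> J y -> J x' -> J y' ->
    `|c x y + u y - (c x' y' + u y')| <= L * (`|x - x'| + `|y - y'|))
  (Sconv : forall s, S s -> convex_fun_on J (fun y => c s y + u y)).

(* Largest minorant of [c + u] that agrees with it on [S] and is [L]-Lipschitz in
   the first variable; as a supremum over [S] it is convex in the second. *)
Definition convexified x y :=
  sup [set c s (pi y) + u (pi y) - L * `|pi x - s| | s in S].

Let piJ x : J (pi x). Proof. exact: clamp_itv. Qed.

Lemma convexified_ub x y s : S s ->
  c s (pi y) + u (pi y) - L * `|pi x - s| <= c (pi x) (pi y) + u (pi y).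
Proof.
move=> Ss; have := cL (SJ Ss) (piJ y) (piJ x) (piJ y).
by rewrite subrr normr0 addr0 distrC (distrC s) ler_norml => /andP[]; lra.
Qed.

Lemma convexified_le x y : convexified x y <= c (pi x) (pi y) + u (pi y).
Proof.
apply: ge_sup; first by have [s Ss] := S0; eexists; exists s.
by move=> _ [s Ss <-]; exact: convexified_ub.
Qed.

Lemma convexified_ge x y s : S s ->
  c s (pi y) + u (pi y) - L * `|pi x - s| <= convexified x y.
Proof.
move=> Ss; apply: ub_le_sup; last by exists s.
by exists (c (pi x) (pi y) + u (pi y)) => _ [t St <-]; exact: convexified_ub.
Qed.

Lemma convexified_least x y b :
  (forall s, S s -> c s (pi y) + u (pi y) - L * `|pi x - s| <= b) ->
  convexified x y <= b.
Proof.
move=> h; apply: ge_sup; first by have [s Ss] := S0; eexists; exists s.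
by move=> _ [s Ss <-]; exact: h.
Qed.

Lemma convexifiedE x y : S x -> convexified x y = c x (pi y) + u (pi y).
Proof.
move=> Sx; have xJ := SJ Sx; apply/eqP; rewrite eq_le; apply/andP; split.
  by have := convexified_le x y; rewrite (clamp_id xJ).
have := convexified_ge x y Sx.
by rewrite (clamp_id xJ) subrr normr0 mulr0 subr0.
Qed.

Lemma convexified_lip x y x' y' :
  `|convexified x y - convexified x' y'| <= L * (`|x - x'| + `|y - y'|).
Proof.
have key a b a' b' : convexified a b <= convexified a' b' + L * (`|a - a'| + `|b - b'|).
  apply: convexified_least => s Ss; have := convexified_ge a' b' Ss.
  have := cL (SJ Ss) (piJ b) (SJ Ss) (piJ b').
  rewrite subrr normr0 add0r ler_norml => /andP[_].
  have : L * `|pi a' - s| <= L * `|pi a - s| + L * `|a - a'|.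
    rewrite -mulrDr ler_wpM2l//.
    have := clamp_lip l r a' a; have := ler_normD (pi a' - pi a) (pi a - s).
    by rewrite addrA subrK (distrC a a'); lra.
  have : L * `|pi b - pi b'| <= L * `|b - b'| by rewrite ler_wpM2l// clamp_lip.
  by lra.
rewrite ler_norml; apply/andP; split; last by have := key x y x' y'; lra.
by have := key x' y' x y; rewrite (distrC x') (distrC y'); lra.
Qed.

Lemma convexified_clamp x y : convexified x y = convexified (pi x) (pi y).
Proof. by rewrite /convexified !clampK. Qed.

Lemma convexified_convex x : convex_fun_on J (convexified x).
Proof.
move=> y z t Jy Jz t01; have /andP[t0 t1] := t01.
have Jyz : J (t * y + (1 - t) * z).
  have t1' : 0 <= 1 - t by rewrite subr_ge0.
  move: Jy Jz => /andP[y1 y2] /andP[z1 z2].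
  have := ler_wpM2l t0 y1; have := ler_wpM2l t0 y2.
  have := ler_wpM2l t1' z1; have := ler_wpM2l t1' z2.
  by move=> ? ? ? ?; apply/andP; split; lra.
apply: convexified_least => s Ss.
have := Sconv Ss Jy Jz t01; rewrite (clamp_id Jyz) => h.
have h1 := convexified_ge x y Ss; have h2 := convexified_ge x z Ss.
rewrite (clamp_id Jy) in h1; rewrite (clamp_id Jz) in h2.
have h3 := ler_wpM2l t0 h1.
have h4 : (1 - t) * (c s z + u z - L * `|pi x - s|) <= (1 - t) * convexified x z.
  by rewrite ler_wpM2l// subr_ge0.
by lra.
Qed.

End convexified_cost.

Section coupling_cost.
Variables (R : realType) (l r : R) (mu nu : probability R R) (c : R -> R -> R).
Variables (C : R -> R -> R) (u : R -> R).
Hypotheses (mc : measurable_fun setT (fun z : R * R => (c z.1 z.2)%:E))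
  (bC : bm (fun z : R * R => C z.1 z.2)) (bu : bm u)
  (cC : forall P, coupling mu nu P ->
    {ae P, forall z : R * R, c z.1 z.2 = C z.1 z.2 - u z.2}).

(** [Y] has law [nu] under every coupling, so passing from [c] to [C] shifts all costs by the same
    constant. *)
Lemma cost_expE P : coupling mu nu P ->
  cost_exp c P = (\int[P]_z C z.1 z.2 - \int[nu]_y u y)%:E.
Proof.
move=> cP; rewrite /cost_exp -(int_snd cP)// -bm_intB//; last exact: bm_snd.
have b : bm (fun z : R * R => C z.1 z.2 - u z.2) by apply: bmB => //; exact: bm_snd.
rewrite -bm_integralE//; apply: ae_eq_integral => //.
  by apply/measurable_EFinP; case: b.
by apply: filterS (cC cP) => z /= -> _.
Qed.

End coupling_cost.

Lemma restrict_integral (R : realType) (l r : R) (m : probability R R) (f : R -> R)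
    (v : \bar R) : {ae m, forall x, l <= x <= r} -> bm f ->
  (\int[m]_x (if (l <= x <= r)%R then (f x)%:E else v) = (\int[m]_x f x)%:E)%E.
Proof.
move=> mJ bf; rewrite -bm_integralE//.
have mf : measurable_fun setT (EFin \o f) by apply/measurable_EFinP; case: bf.
apply: ae_eq_integral => //.
  apply: measurable_fun_ifT => //.
  by apply: measurable_and; apply: measurable_fun_ler.
by apply: filterS mJ => x /= -> _.
Qed.

Theorem theorem2p4 (R : realType) (mu nu : probability R R)
  (c : R -> R -> R) (a b u : R -> R) :
  convex_order mu nu ->
  compact (conv_hull (msupport nu)) ->
  lower_semicontinuous (fun z : R * R => (c z.1 z.2)%:E) ->
  mu.-integrable setT (fun x => (a x)%:E) ->
  nu.-integrable setT (fun y => (b y)%:E) ->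
  (forall x y, c x y <= a x + b y) ->
  primal_value mu nu c \is a fin_num ->
  lip2_on (conv_hull (msupport nu)) c ->
  lip_on (conv_hull (msupport nu)) u ->
  {ae mu, forall x, convex_fun_on (conv_hull (msupport nu)) (fun y => c x y + u y)} ->
  exists (f g : R -> \bar R) (h : R -> R),
    [/\ dual_maximizer mu nu c f g h,
        elip_on (conv_hull (msupport nu)) f,
        elip_on (conv_hull (msupport nu)) g,
        (exists M : R, forall x, conv_hull (msupport nu) x -> `|h x| <= M) &
        forall P, minimizer mu nu c P ->
          (\int[nu]_y g y - \int[mu]_x f x = cost_exp c P)%E].
Proof.
move=> co cJ lsc _ _ _ _ [Lc cLc] [Lu uLu] cconv.
have nuJ0 := ae_conv_hull nu.
have [l [r [lr JE]]] := conv_hull_itv cJ.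
rewrite {}JE in cLc uLu cconv nuJ0 * => {cJ}.
have nuJ : {ae nu, forall x, l <= x <= r} by [].
have muJ := convex_order_support lr co nuJ.
pose L := `|Lc| + `|Lu|.
have L0 : 0 <= L by rewrite addr_ge0.
have cL x y x' y' : l <= x <= r -> l <= y <= r -> l <= x' <= r -> l <= y' <= r ->
    `|c x y + u y - (c x' y' + u y')| <= L * (`|x - x'| + `|y - y'|).
  move=> Jx Jy Jx' Jy'.
  have -> : c x y + u y - (c x' y' + u y') = (c x y - c x' y') + (u y - u y') by lra.
  rewrite (le_trans (ler_normD _ _))// mulrDl lerD//.
    rewrite (le_trans (cLc _ _ _ _ Jx Jy Jx' Jy'))// ler_wpM2r ?addr_ge0//.
    exact: ler_norm.
  rewrite (le_trans (uLu _ _ Jy Jy'))// (le_trans (ler_wpM2r _ (ler_norm Lu)))//.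
  by rewrite ler_wpM2l// lerDr.
pose S := [set x | l <= x <= r /\
  convex_fun_on [set y | l <= y <= r] (fun y => c x y + u y)].
have muS : {ae mu, forall x, S x} by apply: filterS2 muJ cconv => x.
(* A set of full measure is not empty, so the suprema over [S] are genuine and not the default value
   of [sup]. *)
have S0 : S !=set0.
  apply: contrapT => /set0P/negP; rewrite negbK => /eqP SE.
  have [N [mN N0 SN]] := muS.
  have NT : N = setT by apply/seteqP; split => // x _; apply: SN; rewrite /= SE.
  by move: N0; rewrite NT probability_setT => -[/eqP]; rewrite oner_eq0.
have SJ : S `<=` [set x | l <= x <= r] by move=> x [].
have Sconv s : S s -> convex_fun_on [set y | l <= y <= r] (fun y => c s y + u y).
  by move=> [].
pose C := convexified l r L c u S.
have CL := convexified_lip lr L0 S0 SJ cL : forall x y x' y',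
  `|C x y - C x' y'| <= L * (`|x - x'| + `|y - y'|).
have Cp := convexified_clamp L c u S lr : forall x y, C x y = C (clamp l r x) (clamp l r y).
have Cconv x : l <= x <= r -> convex_fun_on [set y | l <= y <= r] (C x).
  by move=> _; exact: (convexified_convex lr S0 SJ cL Sconv).
have [f [g [h [P [[lf lg bf bg bh] fgh MP PE]]]]] :=
  core_duality lr L0 CL Cp Cconv muJ nuJ co.
pose pu y := u (clamp l r y).
have bpu : bm pu.
  apply: (@lipf_clamp_bm R l r) => //; last by move=> x; rewrite /pu clampK.
  exists `|Lu| => x y; rewrite (le_trans (uLu _ _ _ _))//=; try exact: clamp_itv.
  apply: (@le_trans _ _ (`|Lu| * `|clamp l r x - clamp l r y|)).
    by rewrite ler_wpM2r// ler_norm.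
  by rewrite ler_wpM2l// clamp_lip.
have bC := cost_bm lr L0 CL Cp.
have mc := lsc_measurable2 lsc.
have cC Q : coupling mu nu Q -> {ae Q, forall z : R * R, c z.1 z.2 = C z.1 z.2 - pu z.2}.
  move=> cQ; have := ae_fst cQ muS; have := ae_snd cQ nuJ.
  apply: filterS2 => z z2 z1.
  by rewrite /C (convexifiedE lr S0 SJ cL _ z1) /pu clamp_id// addrK.
have costE := cost_expE mc bC bpu cC.
have cplE Q : mart_coupling mu nu Q -> coupling mu nu Q.
  by move=> /(mart_coupling_drift lr muJ nuJ)[].
(* The dual inequality is demanded on the whole plane, whereas the Lipschitz bounds on [c] hold on
   the square only; infinite values make it trivial elsewhere. The [u] added to the cost is taken
   back from [g]. *)
pose F x := if l <= x <= r then (f x)%:E else +oo%E.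
pose G y := if l <= y <= r then (g y - pu y)%:E else -oo%E.
have bgu : bm (fun y => g y - pu y) by exact: bmB.
have intFG : (\int[nu]_y G y - \int[mu]_x F x = (\int[nu]_y (g y - pu y) - \int[mu]_x f x)%:E)%E.
  by rewrite /F /G !restrict_integral.
pose slack (z : R * R) := C z.1 z.2 + h z.1 * (clamp l r z.2 - clamp l r z.1) + f z.1 - g z.2.
have bhd := slope_drift_bm lr bh.
have bs1 : bm (fun z : R * R => C z.1 z.2 + h z.1 * (clamp l r z.2 - clamp l r z.1)).
  exact: bmD.
have bs2 : bm (fun z : R * R =>
    C z.1 z.2 + h z.1 * (clamp l r z.2 - clamp l r z.1) + f z.1).
  by apply: bmD => //; exact: bm_fst.
have bs : bm slack by apply: bmB => //; exact: bm_snd.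
have intslack Q : mart_coupling mu nu Q ->
    \int[Q]_z slack z = \int[Q]_z C z.1 z.2 + \int[mu]_x f x - \int[nu]_y g y.
  move=> MQ; have cQ := cplE Q MQ.
  have [_ dQ] := (mart_coupling_drift lr muJ nuJ Q).1 MQ.
  rewrite bm_intB//; last exact: bm_snd.
  rewrite bm_intD//; last exact: bm_fst.
  by rewrite bm_intD// (drift0_bm lr dQ bh) (int_fst cQ)// (int_snd cQ)// addr0.
(* Any minimizer costs at most as much as [P], whose cost is the dual value, so its nonnegative
   slack has integral at most 0. *)
have slack0 Q : minimizer mu nu c Q -> {ae Q, forall z, slack z = 0}.
  move=> [MQ minQ]; apply: bm_int_le0 => // [z|].
    by have := fgh z.1 z.2; rewrite /slack; lra.
  rewrite intslack//.
  have : (cost_exp c Q <= cost_exp c P)%E.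
    by rewrite minQ; apply: ereal_inf_lbound; exists P.
  by rewrite !costE; [rewrite lee_fin PE; lra|exact: cplE|exact: cplE].
exists F, G, h; split.
- split.
  + by split => x; rewrite /F /G; case: ifP.
  + by apply: filterS muJ => x Jx; rewrite /F Jx.
  + by apply: filterS nuJ => x Jx; rewrite /G Jx.
  + move=> x y; rewrite /F /G; case: ifPn => [Jy|_];
    last by rewrite !addNye ?leNye//; case: ifP.
    case: ifPn => [Jx|_]; last by rewrite /= addeNy ?leNye.
    rewrite -!EFinB lee_fin.
    (* Feasibility for [C] passes to [c] at every [x] of the interval, also outside [S], because
       [C <= c + u] on the square. *)
    have := fgh x y; have := convexified_le lr S0 SJ cL x y.
    rewrite -/C /pu !clamp_id//; lra.
  + move=> Q minQ; have [MQ _] := minQ; have cQ := cplE Q MQ.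
    have h1 := slack0 Q minQ; have h2 := ae_clamp muJ nuJ cQ; have h3 := cC Q cQ.
    apply: filterS3 h1 h2 h3 => z; rewrite /slack => s0 [J1 J2] cz.
    rewrite /F /G J1 J2 -!EFinB cz; congr EFin.
    by move: s0; rewrite !(clamp_id J1) !(clamp_id J2); lra.
- exists f; split; last by move=> x Jx; rewrite /F Jx.
  by have [M fM] := lf; exists M => x y _ _.
- exists (fun y => g y - u y); split; last by move=> x Jx;
  rewrite /G /pu Jx clamp_id.
  have [M gM] := lg; exists (M + Lu) => x y Jx Jy.
  have -> : g x - u x - (g y - u y) = (g x - g y) - (u x - u y) by lra.
  by rewrite mulrDl (le_trans (ler_normB _ _))// lerD// uLu.
- by have [_ [M hM]] := bh; exists M => x _.
- move=> Q minQ; have [MQ _] := minQ; have cQ := cplE Q MQ.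
  rewrite intFG costE// bm_intB//; congr EFin.
  have : \int[Q]_z slack z = 0.
    rewrite -[RHS](int_cst Q 0); apply: bm_int_ae_eq => //; first exact: bm_cst.
    exact: slack0.
  by rewrite intslack//; lra.
Qed.
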